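(* The boundary value problem $$2y''=y^2-s,\quad s>0,\qquad y(0)=0,\qquad y(s)-s^{1/2}\to0\ \text{ as } s\to\infty,$$ has exactly two solutions $Y_+$ and $Y_-$. They satisfy $(Y_+)'>0$ in $[0,\infty)$, while $(Y_-)'(0)<0$ and $Y_-$ has a unique minimum at some point in $(0,\infty)$. Moreover, both solutions $Y_+$ and $Y_-$ are non-degenerate, in the sense that, for $Y=Y_+$ and for $Y=Y_-$, there do not exist nontrivial bounded smooth solutions $\psi$ of $$\psi''-Y\psi=0\ \text{ in } [0,\infty),\qquad \psi(0)=0.$$
   Context: Solutions $y:[0,\infty)\to\mathbb{R}$ are real-valued and understood in the classical sense. *)

(* Defs.v *)
From Stdlib Require Import Reals.
From Coquelicot Require Import Coquelicot.

Open Scope R_scope.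

(* A function [0,oo) -> R is represented by a total function R -> R whose values
   on negative numbers are irrelevant: it is compared by [eq_on_half_line], and
   derivatives and continuity are taken within [half_line] (one-sided at 0, the
   ordinary two-sided notions at s > 0). *)
Definition half_line (s : R) : Prop := 0 <= s.

Definition eq_on_half_line (f g : R -> R) : Prop :=
  forall s, half_line s -> f s = g s.

(* Classical solutions, in C([0,oo)) with y twice differentiable on (0,oo);
   continuity of y'' on (0,oo) then follows from the equation. *)
Definition bvp_solution (y : R -> R) : Prop :=
  (forall s, half_line s -> continue_in y half_line s) /\
  (exists y' y'' : R -> R, forall s, 0 < s ->
     D_in y y' half_line s /\
     D_in y' y'' half_line s /\
     2 * y'' s = y s ^ 2 - s) /\
  y 0 = 0 /\
  is_lim (fun s => y s - sqrt s) p_infty 0.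

Definition smooth_on_half_line (f : R -> R) : Prop :=
  exists d : nat -> R -> R,
    eq_on_half_line (d 0%nat) f /\
    forall n s, half_line s -> D_in (d n) (d (S n)) half_line s.

Definition bounded_on_half_line (f : R -> R) : Prop :=
  exists M : R, forall s, half_line s -> Rabs (f s) <= M.

Definition linearized_solution (Y psi : R -> R) : Prop :=
  (exists psi' psi'' : R -> R, forall s, half_line s ->
     D_in psi psi' half_line s /\
     D_in psi' psi'' half_line s /\
     psi'' s - Y s * psi s = 0) /\
  psi 0 = 0.

Definition nondegenerate (Y : R -> R) : Prop :=
  ~ exists psi : R -> R,
      smooth_on_half_line psi /\
      bounded_on_half_line psi /\
      linearized_solution Y psi /\
      ~ eq_on_half_line psi (fun _ => 0).

(* The minimum of f over [0,oo) is attained at s0 and nowhere else. *)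
Definition unique_minimum_at (f : R -> R) (s0 : R) : Prop :=
  half_line s0 /\ forall s, half_line s -> s <> s0 -> f s0 < f s.

(* Main.v *)
(* Write F = y'^2 - (sqrt s - y)^2 (y + 2 sqrt s) / 3, so that F' = y - sqrt s along solutions.
   A solution y of the boundary value problem stays below sqrt s (maximum principle), so F
   decreases, and the decay of y - sqrt s forces F > 0.  Hence y' = 0 only where
   y < -2 sqrt s, i.e. at a strict minimum: y' never vanishes if y'(0) > 0, and vanishes
   exactly once if y'(0) < 0, while y'(0) = 0 is impossible.

   Existence is by shooting in a = y'(0).  The slopes for which y crosses sqrt s and those for
   which F becomes negative below sqrt s form disjoint open sets; a = 0 is in the second one and
   large |a| in the first one, and a slope in neither yields a solution.

   For y'(0) > 0, uniqueness and nondegeneracy follow from convexity of d^2 when d'' = q d,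
   q >= 0.  For y'(0) < 0, let d be the difference of two solutions y1, y2 (or a bounded
   solution of the linearization), q = (y1 + y2)/2 and w = q', so that d'' = q d.  Then
   (d w' - d' w - c d^3)' = - d / 2 with c = 1/12 (resp. c = 0).  The Wronskian of d and q gives
   d a first zero z, where q < 0.  The identity on [0, z], together with a bound on the position
   of the minimum of y1, yields w(z) > 0; the identity beyond z then contradicts both a second
   zero and boundedness of d. *)
Require Import Defs.
From Stdlib Require Import Reals Lra Lia.
From Coquelicot Require Import Coquelicot.

Open Scope R_scope.

(** * Monotonicity, zeros and energy estimates *)


(** For frozen s the equation has a saddle at y = sqrt s, and F is the energy y'^2 - y^3/3 + s y
    measured from that saddle. The obstacle is the decreasing branch: its potential is negative near
    0, so d^2 need not be convex. Differentiating the equation gives a substitute, because y' solves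
    the linearization up to the constant -1/2 left by the explicit s. As a comparison function y' is
    useful only where it is positive, hence not before the minimum m. On [0, z] concavity gives d <=
    d'(0) s, so the forcing accumulates to at most d'(0) z^2/4; to be outweighed by the initial term
    - d'(0) w(0) it needs z^2 < 4 |w(0)|. This is why the bound on the minimum has the form m^2 < 4
    |y'(0)|. Shooting needs solutions on all of [0,oo), whereas the quadratic equation may blow up.
    It is therefore run on a clipped equation, Lipschitz in y on bounded time intervals, and the
    clip is shown to be inactive on solutions that stay below sqrt s. *)

Lemma derive_continuity_pt (f : R -> R) (x l : R) :
  is_derive f x l -> continuity_pt f x.
Proof.
  intros H. apply derivable_continuous_pt. exists l.
  now apply is_derive_Reals.
Qed.

Lemma mvt (f f' : R -> R) (a b : R) :
  a < b -> (forall s, a <= s <= b -> is_derive f s (f' s)) ->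
  exists c, a < c < b /\ f b - f a = f' c * (b - a).
Proof.
  intros ab H. destruct (MVT_cor2 f f' a b ab) as [c [E Hc]].
  - intros s Hs. now apply is_derive_Reals, H.
  - now exists c.
Qed.

Lemma derive_nonneg_le (f f' : R -> R) (a b : R) :
  a <= b -> (forall s, a <= s <= b -> is_derive f s (f' s)) ->
  (forall s, a <= s <= b -> 0 <= f' s) -> f a <= f b.
Proof.
  intros ab H P. destruct (Req_dec a b) as [->|ne]; [lra|].
  destruct (mvt f f' a b ltac:(lra) H) as [c [Hc E]].
  specialize (P c ltac:(lra)). nra.
Qed.

Lemma derive_pos_lt (f f' : R -> R) (a b : R) :
  a < b -> (forall s, a <= s <= b -> is_derive f s (f' s)) ->
  (forall s, a < s < b -> 0 < f' s) -> f a < f b.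
Proof.
  intros ab H P. destruct (mvt f f' a b ab H) as [c [Hc E]].
  specialize (P c Hc). nra.
Qed.

Lemma derive_nonpos_le (f f' : R -> R) (a b : R) :
  a <= b -> (forall s, a <= s <= b -> is_derive f s (f' s)) ->
  (forall s, a <= s <= b -> f' s <= 0) -> f b <= f a.
Proof.
  intros ab H P. destruct (Req_dec a b) as [->|ne]; [lra|].
  destruct (mvt f f' a b ltac:(lra) H) as [c [Hc E]].
  specialize (P c ltac:(lra)). nra.
Qed.

Lemma derive_neg_lt (f f' : R -> R) (a b : R) :
  a < b -> (forall s, a <= s <= b -> is_derive f s (f' s)) ->
  (forall s, a < s < b -> f' s < 0) -> f b < f a.
Proof.
  intros ab H P. destruct (mvt f f' a b ab H) as [c [Hc E]].
  specialize (P c Hc). nra.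
Qed.

Lemma continuity_pt_eps (f : R -> R) (x : R) :
  continuity_pt f x -> forall eps, 0 < eps ->
  exists del, 0 < del /\ forall t, Rabs (t - x) < del -> Rabs (f t - f x) < eps.
Proof.
  intros H eps He. destruct (H eps He) as [del [Hd P]].
  exists del; split; [exact Hd|]. intros t Ht.
  destruct (Req_dec t x) as [->|ne].
  - rewrite Rminus_diag, Rabs_R0; exact He.
  - apply (P t). split; [split; [exact I|now apply not_eq_sym]|exact Ht].
Qed.

Lemma continuity_pt_pos (f : R -> R) (x : R) :
  continuity_pt f x -> 0 < f x ->
  exists del, 0 < del /\ forall t, Rabs (t - x) < del -> 0 < f t.
Proof.
  intros H P. destruct (continuity_pt_eps f x H (f x) P) as [d [Hd Q]].
  exists d; split; [exact Hd|]. intros t Ht. specialize (Q t Ht).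
  apply Rabs_def2 in Q. lra.
Qed.

(** A supremum argument rather than the bare intermediate value theorem, because the applications
    use the sign of h on the whole interval before the zero. *)
Lemma first_zero (h : R -> R) (a b : R) :
  a < b -> (forall s, a <= s <= b -> continuity_pt h s) -> 0 < h a -> h b <= 0 ->
  exists c, a < c <= b /\ h c = 0 /\ forall s, a <= s < c -> 0 < h s.
Proof.
  intros ab C ha hb.
  set (E := fun x => a <= x <= b /\ forall s, a <= s <= x -> 0 < h s).
  destruct (completeness E) as [c [ub lub]].
  - exists b. intros x [Hx _]; lra.
  - exists a. split; [lra|]. intros s Hs. now replace s with a by lra.
  - assert (ac : a <= c) by (apply ub; split; [lra|]; intros s Hs; now replace s with a by lra).
    assert (cb : c <= b) by (apply lub; intros x [Hx _]; lra).
    assert (below : forall s, a <= s < c -> 0 < h s).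
    { intros s Hs. destruct (Rlt_le_dec 0 (h s)) as [|N]; [assumption|].
      assert (c <= s); [|lra]. apply lub. intros x [Hx Px].
      destruct (Rle_lt_dec x s); [assumption|]. specialize (Px s ltac:(lra)). lra. }
    assert (hc : h c = 0).
    { destruct (Rtotal_order (h c) 0) as [N|[Z|P]]; [|assumption|].
      - assert (a < c) by (destruct (Req_dec a c) as [<-|]; lra).
        destruct (continuity_pt_pos (fun s => - h s) c) as [d [Hd Q]];
          [apply continuity_pt_opp, C; lra|lra|].
        set (t := Rmax a (c - d / 2)).
        assert (a <= t < c /\ Rabs (t - c) < d) as [Ht Hdt].
        { unfold t, Rmax. destruct (Rle_dec a (c - d / 2)); split; try lra;
          apply Rabs_def1; lra. }
        specialize (Q t Hdt). specialize (below t Ht). lra.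
      - destruct (continuity_pt_pos h c) as [d [Hd Q]]; [apply C; lra|lra|].
        assert (c < b) by (destruct (Req_dec c b) as [->|]; lra).
        set (t := Rmin b (c + d / 2)).
        assert (c < t <= b /\ t - c < d) as [Ht Hdt].
        { unfold t, Rmin. destruct (Rle_dec b (c + d / 2)); lra. }
        assert (t <= c); [|lra]. apply ub. split; [lra|]. intros s Hs.
        destruct (Rlt_le_dec s c); [apply below; lra|].
        apply Q, Rabs_def1; lra. }
    exists c. repeat split; auto.
    destruct (Req_dec a c) as [<-|]; lra.
Qed.

Lemma derive_pos_right (f : R -> R) (x l : R) :
  is_derive f x l -> 0 < l ->
  exists del, 0 < del /\ forall t, x < t < x + del -> f x < f t.
Proof.
  intros H L. apply is_derive_Reals in H. destruct (H l L) as [d P].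
  exists d; split; [apply cond_pos|]. intros t Ht.
  specialize (P (t - x) ltac:(lra)).
  assert (Q : Rabs (t - x) < d) by (apply Rabs_def1; lra).
  specialize (P Q). replace (x + (t - x)) with t in P by ring.
  apply Rabs_def2 in P.
  assert (0 < (f t - f x) / (t - x)) by lra.
  apply Rmult_lt_compat_r with (r := t - x) in H0; [|lra].
  replace ((f t - f x) / (t - x) * (t - x)) with (f t - f x) in H0 by (field; lra). lra.
Qed.

Lemma derive_neg_right (f : R -> R) (x l : R) :
  is_derive f x l -> l < 0 ->
  exists del, 0 < del /\ forall t, x < t < x + del -> f t < f x.
Proof.
  intros H L. destruct (derive_pos_right (fun t => - f t) x (- l)) as [d [Hd P]].
  - now apply (is_derive_opp f).
  - lra.
  - exists d; split; [exact Hd|]. intros t Ht. specialize (P t Ht). lra.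
Qed.

Lemma derive_neg_left (f : R -> R) (x l : R) :
  is_derive f x l -> l < 0 ->
  exists del, 0 < del /\ forall t, x - del < t < x -> f x < f t.
Proof.
  intros H L. apply is_derive_Reals in H. destruct (H (- l) ltac:(lra)) as [d P].
  exists d; split; [apply cond_pos|]. intros t Ht.
  specialize (P (t - x) ltac:(lra)).
  assert (Q : Rabs (t - x) < d) by (apply Rabs_def1; lra).
  specialize (P Q). replace (x + (t - x)) with t in P by ring.
  apply Rabs_def2 in P.
  assert (0 < - ((f t - f x) / (t - x))) by lra.
  apply Rmult_lt_compat_r with (r := x - t) in H0; [|lra].
  replace (- ((f t - f x) / (t - x)) * (x - t)) with (f t - f x) in H0 by (field; lra). lra.
Qed.

Lemma derive_pos_left (f : R -> R) (x l : R) :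
  is_derive f x l -> 0 < l ->
  exists del, 0 < del /\ forall t, x - del < t < x -> f t < f x.
Proof.
  intros H L. destruct (derive_neg_left (fun t => - f t) x (- l)) as [d [Hd P]].
  - now apply (is_derive_opp f).
  - lra.
  - exists d; split; [exact Hd|]. intros t Ht. specialize (P t Ht). lra.
Qed.

Lemma first_zero_derive (h : R -> R) (a c l : R) :
  a < c -> (forall s, a < s < c -> 0 < h s) -> h c = 0 -> is_derive h c l -> l <= 0.
Proof.
  intros ac P Z D. destruct (Rle_lt_dec l 0) as [|N]; [assumption|].
  destruct (derive_pos_left h c l D N) as [d [Hd Q]].
  set (t := Rmax ((a + c) / 2) (c - d / 2)).
  assert (a < t < c /\ c - d < t) as [Ht Hdt].
  { unfold t, Rmax. destruct (Rle_dec ((a + c) / 2) (c - d / 2)); lra. }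
  specialize (P t Ht). specialize (Q t ltac:(lra)). lra.
Qed.

(** The slope at p may be nonzero: then f increases strictly to one side of p at once. If it is
    zero, f' is positive just to the right of p. *)
Lemma not_local_max (f f' : R -> R) (p r l : R) :
  0 < r -> (forall s, p - r < s < p + r -> is_derive f s (f' s)) ->
  is_derive f' p l -> 0 < l ->
  exists t, p - r < t < p + r /\ f p < f t.
Proof.
  intros Hr D D' L.
  destruct (Rtotal_order (f' p) 0) as [N|[Z|P]].
  - destruct (derive_neg_left f p (f' p) (D p ltac:(lra)) N) as [d [Hd Q]].
    exists (p - Rmin d r / 2).
    assert (0 < Rmin d r) by now apply Rmin_pos.
    pose proof (Rmin_l d r). pose proof (Rmin_r d r).
    split; [lra|]. apply Q. lra.
  - destruct (derive_pos_right f' p l D' L) as [d [Hd Q]].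
    exists (p + Rmin d r / 2).
    assert (0 < Rmin d r) by now apply Rmin_pos.
    pose proof (Rmin_l d r). pose proof (Rmin_r d r).
    split; [lra|]. apply (derive_pos_lt f f'); [lra|intros; apply D; lra|].
    intros s Hs. specialize (Q s ltac:(lra)). lra.
  - destruct (derive_pos_right f p (f' p) (D p ltac:(lra)) P) as [d [Hd Q]].
    exists (p + Rmin d r / 2).
    assert (0 < Rmin d r) by now apply Rmin_pos.
    pose proof (Rmin_l d r). pose proof (Rmin_r d r).
    split; [lra|]. apply Q. lra.
Qed.

Lemma concave_chord (f f' : R -> R) (a b c : R) :
  a <= c <= b -> (forall s, a <= s <= b -> is_derive f s (f' s)) ->
  (forall s t, a <= s <= t -> t <= b -> f' t <= f' s) ->
  (b - c) * f a + (c - a) * f b <= (b - a) * f c.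
Proof.
  intros H D M.
  destruct (Req_dec a c) as [<-|]; [nra|].
  destruct (Req_dec c b) as [->|]; [nra|].
  destruct (mvt f f' a c) as [x [Hx E]]; [lra|intros; apply D; lra|].
  destruct (mvt f f' c b) as [z [Hz E']]; [lra|intros; apply D; lra|].
  specialize (M x z ltac:(lra) ltac:(lra)).
  assert (f' z * ((b - c) * (c - a)) <= f' x * ((b - c) * (c - a))).
  { apply Rmult_le_compat_r; [nra|assumption]. }
  nra.
Qed.

(** Gronwall: 2 d e <= d^2 + e^2 and 2 e g <= L (d^2 + e^2), so (d^2 + e^2) exp (- (1 + L) s) is
    nonincreasing. It serves both uniqueness and continuous dependence. *)
Lemma energy_bound (d e g : R -> R) (L T : R) :
  0 <= L -> 0 <= T ->
  (forall s, 0 <= s <= T -> is_derive d s (e s)) ->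
  (forall s, 0 <= s <= T -> is_derive e s (g s)) ->
  (forall s, 0 <= s <= T -> Rabs (g s) <= L * Rabs (d s)) ->
  d T ^ 2 + e T ^ 2 <= (d 0 ^ 2 + e 0 ^ 2) * exp ((1 + L) * T).
Proof.
  intros HL HT Dd De B.
  assert (M : (d T ^ 2 + e T ^ 2) * exp (- ((1 + L) * T)) <= (d 0 ^ 2 + e 0 ^ 2) * exp (- ((1 + L) * 0))).
  { apply (derive_nonpos_le (fun s => (d s ^ 2 + e s ^ 2) * exp (- ((1 + L) * s)))
      (fun s => (2 * d s * e s + 2 * e s * g s - (1 + L) * (d s ^ 2 + e s ^ 2)) * exp (- ((1 + L) * s)))
      0 T HT).
    - intros s Hs. pose proof (Dd s Hs) as D1. pose proof (De s Hs) as D2.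
      auto_derive; [repeat split; eexists; eassumption|].
      change (fun x => d x) with d. change (fun x => e x) with e.
      rewrite (is_derive_unique _ _ _ D1), (is_derive_unique _ _ _ D2). ring.
    - intros s Hs. specialize (B s Hs).
      assert (0 < exp (- ((1 + L) * s))) by apply exp_pos.
      assert (2 * d s * e s + 2 * e s * g s - (1 + L) * (d s ^ 2 + e s ^ 2) <= 0); [|nra].
      assert (e s * g s <= L * (Rabs (d s) * Rabs (e s))).
      { apply Rle_trans with (1 := Rle_abs _). rewrite Rabs_mult.
        pose proof (Rabs_pos (e s)). nra. }
      assert (Rabs (d s) * Rabs (e s) * 2 <= d s ^ 2 + e s ^ 2).
      { rewrite <- (pow2_abs (d s)), <- (pow2_abs (e s)).
        pose proof (pow2_ge_0 (Rabs (d s) - Rabs (e s))). nra. }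
      pose proof (pow2_ge_0 (d s - e s)).
      assert (2 * (d s * e s) <= d s ^ 2 + e s ^ 2) by nra.
      nra. }
  replace (- ((1 + L) * 0)) with 0 in M by ring. rewrite exp_0, Rmult_1_r, exp_Ropp in M.
  apply Rmult_le_compat_r with (r := exp ((1 + L) * T)) in M; [|left; apply exp_pos].
  rewrite Rmult_assoc, Rinv_l in M; [lra|]. pose proof (exp_pos ((1 + L) * T)). lra.
Qed.

(** * The defect F and the maximum principle *)


(** Derivatives are two-sided even at 0, so that ordinary calculus applies up to the boundary;
    [bvp_solution_connection] passes to this form from the one-sided notion. *)
Definition flow (y v : R -> R) (s : R) : Prop :=
  is_derive y s (v s) /\ is_derive v s ((y s ^ 2 - s) / 2).

Definition ivp_solution (y v : R -> R) : Prop :=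
  y 0 = 0 /\ forall s, 0 <= s -> flow y v s.

Definition connection (y v : R -> R) : Prop :=
  ivp_solution y v /\ is_lim (fun s => y s - sqrt s) p_infty 0.

(** Expanded, this is v^2 - y^3/3 + s y - (2/3) s^(3/2); the factored form shows its sign when v =
    0. *)
Definition defect (y v : R -> R) (s : R) : R :=
  v s ^ 2 - (sqrt s - y s) ^ 2 * (y s + 2 * sqrt s) / 3.

Lemma defect_derive (y v : R -> R) (s : R) :
  0 < s -> flow y v s -> is_derive (defect y v) s (y s - sqrt s).
Proof.
  intros Hs [D1 D2]. unfold defect.
  assert (0 < sqrt s) by now apply sqrt_lt_R0.
  auto_derive; [repeat split; try (eexists; eassumption); assumption|].
  change (fun x => y x) with y. change (fun x => v x) with v.
  rewrite (is_derive_unique _ _ _ D1), (is_derive_unique _ _ _ D2).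
  rewrite <- (sqrt_sqrt s) at 2 by lra. field. lra.
Qed.

Lemma defect_continuity (y v : R -> R) (s : R) :
  0 <= s -> flow y v s -> continuity_pt (defect y v) s.
Proof.
  intros Hs [D1 D2]. apply derive_continuity_pt in D1. apply derive_continuity_pt in D2.
  pose proof (continuity_pt_sqrt s Hs) as C.
  assert (C2 : continuity_pt (fun x => v x ^ 2 - (sqrt x - y x) ^ 2 * (y x + 2 * sqrt x) * / 3) s); [|exact C2].
  apply (continuity_pt_minus (fun x => v x ^ 2)).
  - apply (continuity_pt_comp v (fun z => z ^ 2)); [assumption|].
    apply derivable_continuous_pt, derivable_pt_pow.
  - apply (continuity_pt_mult (fun x => (sqrt x - y x) ^ 2 * (y x + 2 * sqrt x)) (fun _ => / 3)).
    + apply (continuity_pt_mult (fun x => (sqrt x - y x) ^ 2)).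
      * apply (continuity_pt_comp (fun x => sqrt x - y x) (fun z => z ^ 2)).
        -- now apply (continuity_pt_minus sqrt y).
        -- apply derivable_continuous_pt, derivable_pt_pow.
      * apply (continuity_pt_plus y (fun x => 2 * sqrt x)); [assumption|].
        now apply (continuity_pt_scal sqrt 2).
    + apply continuity_pt_const. now intros ? ?.
Qed.

(** The mean value theorem is used in the form with continuity at the ends and derivatives only
    inside, since a may be 0, where sqrt is not differentiable. *)
Lemma defect_le (y v : R -> R) (a b : R) :
  0 <= a <= b -> (forall s, a <= s <= b -> flow y v s) ->
  (forall s, a < s < b -> y s <= sqrt s) -> defect y v b <= defect y v a.
Proof.
  intros H Fl W. destruct (Req_dec a b) as [->|ne]; [lra|].
  destruct (MVT (defect y v) id a b) with
    (pr1 := fun c (Hc : a < c < b) => exist (fun l => derivable_pt_abs (defect y v) c l) (y c - sqrt c)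
       (proj1 (is_derive_Reals _ _ _) (defect_derive y v c ltac:(lra) (Fl c ltac:(lra)))))
    (pr2 := fun c (Hc : a < c < b) => derivable_pt_id c) as [c [Hc E]].
  - lra.
  - intros c Hc. apply defect_continuity; [lra|apply Fl; lra].
  - intros c Hc. apply derivable_continuous_pt, derivable_pt_id.
  - rewrite (derive_pt_eq_0 id c 1 _ (derivable_pt_lim_id c)) in E.
    unfold id in E. simpl in E. specialize (W c Hc).
    nra.
Qed.

Lemma defect_lt (y v : R -> R) (a b : R) :
  0 <= a < b -> (forall s, a <= s <= b -> flow y v s) ->
  (forall s, a < s < b -> y s < sqrt s) -> defect y v b < defect y v a.
Proof.
  intros H Fl W.
  (* The strict decrease is taken from the middle third, away from a possible endpoint 0. *)
  set (c := (2 * a + b) / 3). set (d := (a + 2 * b) / 3).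
  assert (a < c /\ c < d /\ d < b) as [H1 [H2 H3]] by (unfold c, d; lra).
  apply Rle_lt_trans with (defect y v d);
    [apply defect_le; [lra|intros; apply Fl; lra|intros s Hs; left; apply W; lra]|].
  apply Rlt_le_trans with (defect y v c);
    [|apply defect_le; [lra|intros; apply Fl; lra|intros s Hs; left; apply W; lra]].
  apply (derive_neg_lt _ (fun s => y s - sqrt s)); [lra| |].
  - intros s Hs. apply defect_derive; [lra|apply Fl; lra].
  - intros s Hs. specialize (W s ltac:(lra)). lra.
Qed.

(* Maximum principle: [sqrt] is a strict supersolution. *)
Lemma below_sqrt (y v g : R -> R) (a b c : R) :
  y 0 = 0 ->
  (forall s, 0 <= s <= b -> is_derive y s (v s)) ->
  (forall s, 0 <= s <= b -> is_derive v s (g s)) ->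
  (forall s, 0 < s < b -> sqrt s <= y s -> 0 <= g s) ->
  0 <= c -> y b - sqrt b <= c -> 0 < a < b -> y a - sqrt a < c.
Proof.
  intros y0 D1 D2 G Hc Wb Hab.
  destruct (Rlt_le_dec (y a - sqrt a) c) as [|Wa]; [assumption|exfalso].
  destruct (continuity_ab_maj (fun s => y s - sqrt s) 0 b) as [p [Max Hp]]; [lra| |].
  { intros s Hs. apply (continuity_pt_minus y sqrt).
    - now apply derive_continuity_pt with (v s), D1.
    - apply continuity_pt_sqrt; lra. }
  (* At either end y - sqrt is at most c, hence at most its value at a; so an interior maximum point
     always exists. *)
  assert (Q : exists q, 0 < q < b /\ c <= y q - sqrt q /\ forall s, 0 <= s <= b -> y s - sqrt s <= y q - sqrt q).
  { destruct (Req_dec p 0) as [->|p0]; [|destruct (Req_dec p b) as [->|pb]].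
    - exists a. split; [lra|split; [lra|]]. intros s Hs. specialize (Max s Hs). simpl in Max.
      rewrite y0, sqrt_0 in Max. lra.
    - exists a. split; [lra|split; [lra|]]. intros s Hs. specialize (Max s Hs). simpl in Max. lra.
    - exists p. split; [lra|split]; [|exact Max]. specialize (Max a ltac:(lra)). simpl in Max. lra. }
  destruct Q as [q [Hq [Wq Mq]]].
  set (r := Rmin q (b - q)).
  assert (0 < r) by (apply Rmin_pos; lra).
  pose proof (Rmin_l q (b - q)). pose proof (Rmin_r q (b - q)). fold r in H0, H1.
  assert (0 < sqrt q) by (apply sqrt_lt_R0; lra).
  destruct (not_local_max (fun s => y s - sqrt s) (fun s => v s - / (2 * sqrt s)) q r
      (g q + / (4 * sqrt q ^ 3))) as [t [Ht Lt]].
  - assumption.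
  - intros s Hs. specialize (D1 s ltac:(lra)).
    auto_derive; [split; [eexists; eassumption|split; [lra|exact I]]|].
    change (fun x => y x) with y. rewrite (is_derive_unique _ _ _ D1). ring.
  - specialize (D2 q ltac:(lra)).
    auto_derive; [split; [eexists; eassumption|split; [lra|split; [lra|exact I]]]|].
    change (fun x => v x) with v. rewrite (is_derive_unique _ _ _ D2).
    field. lra.
  - specialize (G q Hq ltac:(lra)).
    assert (0 < / (4 * sqrt q ^ 3)) by (apply Rinv_0_lt_compat; pose proof (pow_lt _ 3 H2); lra). lra.
  - specialize (Mq t ltac:(lra)). simpl in Lt. lra.
Qed.

Lemma is_lim_infty_eps (f : R -> R) (eps : R) :
  is_lim f p_infty 0 -> 0 < eps ->
  exists S, forall s, S < s -> Rabs (f s) < eps.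
Proof.
  intros H He. apply is_lim_spec in H. destruct (H (mkposreal eps He)) as [S P].
  exists S. intros s Hs. specialize (P s Hs). simpl in P. now rewrite Rminus_0_r in P.
Qed.

Section Connection.
Context (y v : R -> R) (Hc : connection y v).

Lemma connection_0 : y 0 = 0.
Proof. apply Hc. Qed.

Lemma connection_flow (s : R) : 0 <= s -> flow y v s.
Proof. apply Hc. Qed.

Lemma connection_derive (s : R) : 0 <= s -> is_derive y s (v s).
Proof. apply Hc. Qed.

Lemma connection_derive2 (s : R) : 0 <= s -> is_derive v s ((y s ^ 2 - s) / 2).
Proof. apply Hc. Qed.

(** The maximum principle is applied twice: the limit gives y - sqrt < c for every c > 0, hence y -
    sqrt <= 0, and then c = 0 with right end s + 1 makes the inequality strict. *)
Lemma connection_lt_sqrt (s : R) : 0 < s -> y s < sqrt s.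
Proof.
  assert (le : forall a c, 0 < a -> 0 < c -> y a - sqrt a < c).
  { intros a c Ha Hc'. destruct (is_lim_infty_eps _ c (proj2 Hc) Hc') as [S HS].
    set (b := Rmax (a + 1) (S + 1)).
    pose proof (Rmax_l (a + 1) (S + 1)). pose proof (Rmax_r (a + 1) (S + 1)).
    fold b in H, H0. specialize (HS b ltac:(lra)). apply Rabs_def2 in HS.
    apply (below_sqrt y v (fun s => (y s ^ 2 - s) / 2) a b c); try lra.
    - apply connection_0.
    - intros; apply connection_derive; lra.
    - intros; apply connection_derive2; lra.
    - intros s' Hs' W. rewrite <- (sqrt_sqrt s') at 2 by lra.
      pose proof (sqrt_pos s'). nra. }
  intros Hs.
  assert (W : y (s + 1) - sqrt (s + 1) <= 0).
  { destruct (Rle_lt_dec (y (s + 1) - sqrt (s + 1)) 0) as [|P]; [assumption|].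
    specialize (le (s + 1) _ ltac:(lra) P). lra. }
  enough (y s - sqrt s < 0) by lra.
  apply (below_sqrt y v (fun s => (y s ^ 2 - s) / 2) s (s + 1) 0); try lra.
  - apply connection_0.
  - intros; apply connection_derive; lra.
  - intros; apply connection_derive2; lra.
  - intros s' Hs' W'. rewrite <- (sqrt_sqrt s') at 2 by lra.
    pose proof (sqrt_pos s'). nra.
Qed.

Lemma connection_near_sqrt (eps : R) :
  0 < eps -> exists S, 1 <= S /\ forall s, S <= s -> sqrt s - eps < y s.
Proof.
  intros He. destruct (is_lim_infty_eps _ eps (proj2 Hc) He) as [S HS].
  exists (Rmax 1 (S + 1)). pose proof (Rmax_l 1 (S + 1)). pose proof (Rmax_r 1 (S + 1)).
  split; [assumption|]. intros s Hs. specialize (HS s ltac:(lra)).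
  apply Rabs_def2 in HS. lra.
Qed.

Lemma connection_unbounded (M : R) : exists S, 1 <= S /\ forall s, S <= s -> M < y s.
Proof.
  destruct (connection_near_sqrt 1 ltac:(lra)) as [S [H1 HS]].
  exists (Rmax S ((Rabs M + 1) ^ 2)).
  pose proof (Rmax_l S ((Rabs M + 1) ^ 2)). pose proof (Rmax_r S ((Rabs M + 1) ^ 2)).
  split; [lra|]. intros s Hs. specialize (HS s ltac:(lra)).
  assert (Rabs M + 1 <= sqrt s).
  { pose proof (Rabs_pos M). rewrite <- (sqrt_pow2 (Rabs M + 1)) by lra. apply sqrt_le_1_alt. lra. }
  pose proof (Rle_abs M). lra.
Qed.

(** Once 1 < y < sqrt s, y is concave; a nonpositive slope would persist and contradict that y is
    unbounded. *)
Lemma connection_eventually :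
  exists S, 1 <= S /\ forall s, S <= s -> 1 <= y s /\ 0 < v s.
Proof.
  destruct (connection_unbounded 1) as [S [H1 HS]].
  exists S. split; [assumption|]. intros s Hs. split; [left; now apply HS|].
  destruct (Rlt_le_dec 0 (v s)) as [|N]; [assumption|exfalso].
  assert (vle : forall t, s <= t -> v t <= 0).
  { intros t Ht. apply Rle_trans with (v s); [|assumption].
    apply (derive_nonpos_le v (fun s => (y s ^ 2 - s) / 2)); [lra| |].
    - intros r Hr. apply connection_derive2; lra.
    - intros r Hr. pose proof (HS r ltac:(lra)). pose proof (connection_lt_sqrt r ltac:(lra)).
      rewrite <- (sqrt_sqrt r) at 2 by lra. nra. }
  destruct (connection_unbounded (y s)) as [T [_ HT]].
  set (t := Rmax s T). pose proof (Rmax_l s T). pose proof (Rmax_r s T). fold t in H, H0.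
  specialize (HT t H0).
  assert (y t <= y s); [|lra].
  apply (derive_nonpos_le y v); [assumption| |].
  - intros r Hr. apply connection_derive; lra.
  - intros r Hr. apply vle; lra.
Qed.

(** If F <= - eta from some time on, then (sqrt t - y)^2 sqrt t >= eta, so y'' = - (sqrt t - y)(sqrt
    t + y)/2 <= - sqrt eta / 2 for large t. This drives v below 0, against [connection_eventually].
    Strict decrease of F on [s, s + 1] then makes it positive. *)
Lemma connection_defect_pos (s : R) : 0 <= s -> 0 < defect y v s.
Proof.
  assert (nonneg : forall s, 0 <= s -> 0 <= defect y v s).
  { clear s. intros s Hs. destruct (Rle_lt_dec 0 (defect y v s)) as [|N]; [assumption|exfalso].
    set (eta := - defect y v s). assert (0 < eta) by (unfold eta; lra).
    destruct connection_eventually as [S [S1 HS]].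
    set (a := Rmax s S). pose proof (Rmax_l s S). pose proof (Rmax_r s S). fold a in H0, H1.
    assert (0 < sqrt eta) by now apply sqrt_lt_R0.
    assert (steep : forall t, a <= t -> (y t ^ 2 - t) / 2 <= - sqrt eta / 2).
    { intros t Ht.
      assert (defect y v t <= - eta).
      { replace (- eta) with (defect y v s) by (unfold eta; ring).
        apply defect_le; [lra|intros; apply connection_flow; lra|].
        intros r Hr. left. apply connection_lt_sqrt; lra. }
      destruct (HS t ltac:(lra)) as [Hy _].
      pose proof (connection_lt_sqrt t ltac:(lra)) as Hw.
      assert (1 <= sqrt t) by (rewrite <- sqrt_1; apply sqrt_le_1_alt; lra).
      unfold defect in H3. set (w := sqrt t - y t) in *.
      pose proof (pow2_ge_0 (v t)).
      assert (eta <= w ^ 2 * sqrt t).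
      { assert (w ^ 2 * (y t + 2 * sqrt t) <= w ^ 2 * (3 * sqrt t)) by
          (apply Rmult_le_compat_l; [apply pow2_ge_0|lra]). lra. }
      assert (sqrt eta <= w * sqrt t).
      { rewrite <- (sqrt_pow2 (w * sqrt t)) by (unfold w in *; nra).
        apply sqrt_le_1_alt. assert (0 <= w ^ 2) by apply pow2_ge_0. nra. }
      assert (y t ^ 2 - t = - w * (y t + sqrt t)) by
        (pose proof (sqrt_sqrt t ltac:(lra)); unfold w; nra).
      assert (0 < w) by (unfold w; lra). nra. }
    (* Over this length v drops by at least 2 (v a + 1), more than v a. *)
    destruct (mvt v (fun s => (y s ^ 2 - s) / 2) a (a + 4 * (v a + 1) / sqrt eta)) as [c [Hc' E]].
    - destruct (HS a ltac:(lra)). assert (0 < 4 * (v a + 1) / sqrt eta) by (apply Rdiv_lt_0_compat; lra). lra.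
    - intros t Ht. apply connection_derive2; lra.
    - specialize (steep c ltac:(lra)).
      destruct (HS a ltac:(lra)) as [_ Va].
      destruct (HS (a + 4 * (v a + 1) / sqrt eta) ltac:(lra)) as [_ Vb].
      assert ((y c ^ 2 - c) / 2 * (4 * (v a + 1) / sqrt eta) <= - sqrt eta / 2 * (4 * (v a + 1) / sqrt eta)).
      { apply Rmult_le_compat_r; [left; apply Rdiv_lt_0_compat; lra|assumption]. }
      replace (- sqrt eta / 2 * (4 * (v a + 1) / sqrt eta)) with (- 2 * (v a + 1)) in H3 by (field; lra).
      replace (a + 4 * (v a + 1) / sqrt eta - a) with (4 * (v a + 1) / sqrt eta) in E by ring.
      lra. }
  intros Hs. apply Rle_lt_trans with (defect y v (s + 1)); [apply nonneg; lra|].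
  apply defect_lt; [lra|intros; apply connection_flow; lra|].
  intros r Hr. apply connection_lt_sqrt; lra.
Qed.

End Connection.

(** * Slope and turning point *)


Lemma critical_point (y v : R -> R) (s : R) :
  0 < s -> 0 <= defect y v s -> y s < sqrt s -> v s = 0 -> y s <= -2 * sqrt s.
Proof.
  intros Hs D W V. unfold defect in D. rewrite V in D.
  assert (0 < (sqrt s - y s) ^ 2) by (apply pow_lt; lra). nra.
Qed.

Lemma critical_point_convex (y s : R) : 0 < s -> y <= -2 * sqrt s -> 0 < (y ^ 2 - s) / 2.
Proof.
  intros Hs Y. pose proof (sqrt_lt_R0 s Hs). pose proof (sqrt_sqrt s ltac:(lra)). nra.
Qed.

(** At a first zero of v the derivative of v would be nonpositive, but a critical point with F >= 0
    is strictly convex. Only F >= 0 and y < sqrt are assumed, so that the lemma also serves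
    solutions not yet known to be connections. *)
Lemma slope_stays_pos (y v : R -> R) (a b : R) :
  0 <= a <= b -> 0 < v a ->
  (forall s, a <= s <= b -> flow y v s) ->
  (forall s, a < s <= b -> 0 <= defect y v s /\ y s < sqrt s) ->
  0 < v b.
Proof.
  intros Hab Va Fl D. destruct (Rlt_le_dec 0 (v b)) as [|N]; [assumption|exfalso].
  destruct (first_zero v a b) as [c [Hc [Z P]]]; auto.
  - destruct (Req_dec a b) as [E|]; [rewrite E in Va; lra|lra].
  - intros s Hs. apply derive_continuity_pt with ((y s ^ 2 - s) / 2), Fl; lra.
  - destruct (D c ltac:(lra)) as [Dc Wc].
    pose proof (critical_point_convex (y c) c ltac:(lra)
      (critical_point y v c ltac:(lra) Dc Wc Z)).
    assert ((y c ^ 2 - c) / 2 <= 0); [|lra].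
    apply (first_zero_derive v a c); [lra|intros; apply P; lra|assumption|apply Fl; lra].
Qed.

Section Slope.
Context (y v : R -> R) (Hc : connection y v).

Lemma connection_stays_increasing (a s : R) : 0 <= a <= s -> 0 < v a -> 0 < v s.
Proof.
  intros H Va. apply (slope_stays_pos y v a s H Va).
  - intros; apply (connection_flow y v Hc); lra.
  - intros t Ht. split; [left; apply (connection_defect_pos y v Hc); lra|].
    apply (connection_lt_sqrt y v Hc); lra.
Qed.

(** Because F(0) = v(0)^2 and F is positive. *)
Lemma connection_slope_nonzero : v 0 <> 0.
Proof.
  intros E. pose proof (connection_defect_pos y v Hc 0 ltac:(lra)) as D.
  unfold defect in D. rewrite E, (connection_0 y v Hc), sqrt_0 in D. lra.
Qed.

Lemma connection_turning_point :
  v 0 < 0 -> exists m, 0 < m /\ (forall s, 0 <= s < m -> v s < 0) /\ v m = 0 /\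
    (forall s, m < s -> 0 < v s) /\ y m < -2 * sqrt m.
Proof.
  intros V0. destruct (connection_eventually y v Hc) as [S [S1 HS]].
  destruct (first_zero (fun s => - v s) 0 S) as [m [Hm [Z P]]]; try lra.
  - intros s Hs. apply continuity_pt_opp.
    apply derive_continuity_pt with ((y s ^ 2 - s) / 2), (connection_derive2 y v Hc); lra.
  - destruct (HS S); lra.
  - assert (Vm : v m = 0) by lra.
    assert (Ym : y m < -2 * sqrt m).
    { pose proof (connection_defect_pos y v Hc m ltac:(lra)) as D.
      unfold defect in D. rewrite Vm in D. pose proof (pow2_ge_0 (sqrt m - y m)). nra. }
    exists m. split; [lra|split; [|split; [assumption|split; [|assumption]]]].
    + intros s Hs. specialize (P s ltac:(lra)). lra.
    + intros s Hs.
      destruct (derive_pos_right v m _ (connection_derive2 y v Hc m ltac:(lra))) as [d [Hd Q]].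
      { apply critical_point_convex; lra. }
      set (t := Rmin s (m + d / 2)).
      assert (m < t <= s /\ t < m + d) as [Ht Ht'].
      { unfold t, Rmin. destruct (Rle_dec s (m + d / 2)); lra. }
      apply (connection_stays_increasing t); [lra|].
      specialize (Q t ltac:(lra)). lra.
Qed.

End Slope.

(* With n = sqrt m, monotonicity of [v^2 - y^3/3 + s y] gives
   v(0)^2 >= 2 n^3 / 3, while monotonicity of [v^2 - y^3/3] shows that y reaches -n before
   time (4/7) m if m^2 >= 4 |v 0|.  From then on y is convex, so it lies below the chord from
   -n to -2n, which makes the increment of v too large. *)
Lemma turning_point_early (y v : R -> R) (m : R) :
  ivp_solution y v -> 0 < m -> (forall s, 0 <= s < m -> v s < 0) -> v m = 0 ->
  y m < -2 * sqrt m -> m ^ 2 < 4 * - v 0.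
Proof.
  intros [y0 Fl] Hm Vneg Vm Ym.
  destruct (Rlt_le_dec (m ^ 2) (4 * - v 0)) as [|C]; [assumption|exfalso].
  set (A := - v 0) in *. assert (HA : 0 < A) by (unfold A; specialize (Vneg 0 ltac:(lra)); lra).
  set (n := sqrt m) in *. assert (Hn : 0 < n) by now apply sqrt_lt_R0.
  assert (nm : n * n = m) by (apply sqrt_sqrt; lra).
  assert (Vle : forall s, 0 <= s <= m -> v s <= 0).
  { intros s Hs. destruct (Req_dec s m) as [->|]; [lra|left; apply Vneg; lra]. }
  assert (Ydec : forall a b, 0 <= a <= b -> b <= m -> y b <= y a).
  { intros a b Hab Hb. apply (derive_nonpos_le y v); [lra| |].
    - intros; apply Fl; lra.
    - intros; apply Vle; lra. }
  assert (An : 2 * n ^ 3 / 3 <= A ^ 2).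
  { assert (E : v m ^ 2 - y m ^ 3 / 3 + m * y m <= v 0 ^ 2 - y 0 ^ 3 / 3 + 0 * y 0).
    { apply (derive_nonpos_le (fun s => v s ^ 2 - y s ^ 3 / 3 + s * y s) y); [lra| |].
      - intros s Hs. destruct (Fl s ltac:(lra)) as [D1 D2].
        auto_derive; [repeat split; eexists; eassumption|].
        change (fun x => y x) with y. change (fun x => v x) with v.
        rewrite (is_derive_unique _ _ _ D1), (is_derive_unique _ _ _ D2). field.
      - intros s Hs. rewrite <- y0. apply Ydec; lra. }
    rewrite Vm, y0 in E. replace (A ^ 2) with (v 0 ^ 2) by (unfold A; ring).
    replace (m * y m) with (n * n * y m) in E by (now rewrite nm).
    assert (2 * n ^ 3 / 3 <= - y m ^ 3 / 3 + n * n * y m); [|lra].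
    set (M := - y m). replace (y m) with (- M) by (unfold M; ring).
    assert (2 * n < M) by (unfold M; lra).
    (* M^3 - 3 n^2 M - 2 n^3 = (M - 2 n)(M + n)^2. *)
    assert (0 <= (M - 2 * n) * (M ^ 2 + 2 * M * n + n ^ 2)).
    { apply Rmult_le_pos; [lra|]. nra. }
    nra. }
  assert (G : forall s, 0 <= s <= m -> A ^ 2 <= v s ^ 2 - y s ^ 3 / 3).
  { intros s Hs. replace (A ^ 2) with (v 0 ^ 2 - y 0 ^ 3 / 3) by (rewrite y0; unfold A; field).
    apply (derive_nonneg_le (fun s => v s ^ 2 - y s ^ 3 / 3) (fun s => - (s * v s))); [lra| |].
    - intros t Ht. destruct (Fl t ltac:(lra)) as [D1 D2].
      auto_derive; [repeat split; eexists; eassumption|].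
      change (fun x => y x) with y. change (fun x => v x) with v.
      rewrite (is_derive_unique _ _ _ D1), (is_derive_unique _ _ _ D2). field.
    - intros t Ht. specialize (Vle t ltac:(lra)). nra. }
  (* Squaring 4 A <= m^2 = n^4 gives 16 A^2 <= n^8, while [An] gives 16 A^2 >= 32 n^3 / 3. *)
  assert (n5 : 32 / 3 <= n ^ 5).
  { assert (4 * A <= n ^ 4) by (replace (n ^ 4) with (m ^ 2) by (rewrite <- nm; ring); lra).
    assert (16 * A ^ 2 <= n ^ 8) by (replace (n ^ 8) with (n ^ 4 * n ^ 4) by ring; nra).
    assert (32 / 3 * n ^ 3 <= n ^ 5 * n ^ 3) by (replace (n ^ 5 * n ^ 3) with (n ^ 8) by ring; lra).
    apply Rmult_le_reg_r with (n ^ 3); [now apply pow_lt|assumption]. }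
  destruct (first_zero (fun s => y s + n) 0 m) as [r [Hr [Zr Pr]]]; try lra.
  { intros s Hs. apply (continuity_pt_plus y (fun _ => n)).
    - apply derive_continuity_pt with (v s), Fl; lra.
    - apply continuity_pt_const; now intros ? ?. }
  assert (rm : r < m).
  { destruct (Req_dec r m) as [->|]; lra. }
  (* While y >= - n, v^2 >= A^2 - n^3/3 >= A^2/2 >= n^3/3; this speed bounds the time r needed to
     descend by n. *)
  assert (Hr2 : r ^ 2 <= 3 / n).
  { destruct (mvt y v 0 r) as [c [Hc E]]; [lra|intros; apply Fl; lra|].
    specialize (G c ltac:(lra)). specialize (Pr c ltac:(lra)). simpl in Pr, Zr.
    rewrite y0 in E.
    assert (y c <= 0) by (rewrite <- y0; apply Ydec; lra).
    assert (- y c ^ 3 <= n ^ 3).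
    { replace (- y c ^ 3) with ((- y c) ^ 3) by ring. apply pow_incr. lra. }
    assert (A ^ 2 / 2 <= v c ^ 2) by lra.
    assert (n ^ 2 = v c ^ 2 * r ^ 2) by (replace n with (- (v c * (r - 0))) by lra; ring).
    assert (n ^ 3 / 3 * r ^ 2 <= n ^ 2).
    { rewrite H2. apply Rmult_le_compat_r; [apply pow2_ge_0|lra]. }
    apply Rmult_le_reg_l with (n ^ 3 / 3); [pose proof (pow_lt n 3 Hn); lra|].
    replace (n ^ 3 / 3 * (3 / n)) with (n ^ 2) by (field; lra). assumption. }
  (* 49 r^2 <= 147 / n < 16 n^4 = 16 m^2, because 147 < 16 * 32/3. *)
  assert (r47 : 7 * r < 4 * m).
  { assert (147 < 16 * n ^ 5) by lra.
    assert (49 * r ^ 2 < 16 * n ^ 4).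
    { apply Rle_lt_trans with (147 / n); [lra|].
      apply Rmult_lt_reg_r with n; [assumption|].
      replace (147 / n * n) with 147 by (field; lra). lra. }
    apply Rnot_le_lt. intros N.
    assert ((4 * m) ^ 2 <= (7 * r) ^ 2) by (apply pow_incr; lra).
    replace (16 * n ^ 4) with ((4 * m) ^ 2) in H0 by (rewrite <- nm; ring). lra. }
  assert (Vmono : forall s t, r <= s <= t -> t <= m -> v s <= v t).
  { intros s t Hst Ht. apply (derive_nonneg_le v (fun s => (y s ^ 2 - s) / 2)); [lra| |].
    - intros; apply Fl; lra.
    - intros x Hx. assert (y x <= - n) by (replace (- n) with (y r) by lra; apply Ydec; lra).
      assert (n * n <= y x ^ 2) by nra. lra. }
  set (l := fun s => n + n * (s - r) / (m - r)).
  assert (chord : forall s, r <= s <= m -> l s <= - y s).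
  { intros s Hs.
    assert (K : (m - s) * - y r + (s - r) * - y m <= (m - r) * - y s).
    { apply (concave_chord (fun s => - y s) (fun s => - v s) r m s Hs).
      - intros t Ht. apply (is_derive_opp y), Fl; lra.
      - intros a b Hab Hb. apply Ropp_le_contravar, Vmono; lra. }
    apply Rmult_le_reg_l with (m - r); [lra|].
    replace ((m - r) * l s) with ((m - s) * n + (s - r) * (2 * n)) by (unfold l; field; lra).
    nra. }
  assert (I1 : v 0 + 0 ^ 2 / 4 <= v r + r ^ 2 / 4).
  { apply (derive_nonneg_le (fun s => v s + s ^ 2 / 4) (fun s => y s ^ 2 / 2)); [lra| |].
    - intros t Ht. destruct (Fl t ltac:(lra)) as [D1 D2].
      auto_derive; [repeat split; eexists; eassumption|].
      change (fun x => v x) with v. rewrite (is_derive_unique _ _ _ D2). field.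
    - intros t Ht. pose proof (pow2_ge_0 (y t)). lra. }
  (* (m - r) l^3 / (6 n) is a primitive of l^2 / 2, and v + s^2/4 has derivative y^2/2 >= l^2/2. *)
  assert (I2 : v r + r ^ 2 / 4 - (m - r) * l r ^ 3 / (6 * n) <= v m + m ^ 2 / 4 - (m - r) * l m ^ 3 / (6 * n)).
  { apply (derive_nonneg_le (fun s => v s + s ^ 2 / 4 - (m - r) * l s ^ 3 / (6 * n))
      (fun s => (y s ^ 2 - l s ^ 2) / 2)); [lra| |].
    - intros t Ht. destruct (Fl t ltac:(lra)) as [D1 D2]. unfold l.
      auto_derive; [repeat split; eexists; eassumption|].
      change (fun x => v x) with v. rewrite (is_derive_unique _ _ _ D2). field. lra.
    - intros t Ht. specialize (chord t Ht).
      assert (0 <= l t) by (unfold l; assert (0 <= n * (t - r) / (m - r)) by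
        (apply Rmult_le_pos; [nra|left; apply Rinv_0_lt_compat; lra]); lra).
      nra. }
  replace (l r) with n in I2 by (unfold l; field; lra).
  replace (l m) with (2 * n) in I2 by (unfold l; field; lra).
  replace ((m - r) * n ^ 3 / (6 * n)) with ((m - r) * m / 6) in I2 by (rewrite <- nm; field; lra).
  replace ((m - r) * (2 * n) ^ 3 / (6 * n)) with ((m - r) * m * 8 / 6) in I2 by (rewrite <- nm; field; lra).
  (* The chord contributes 7 m (m - r) / 6, which exceeds m^2/2 exactly when 7 r < 4 m; then m^2/4 >
     - A + m^2/2, against 4 A <= m^2. *)
  rewrite Vm in I2. unfold A in *. nra.
Qed.

(** * Rigidity of bounded perturbations *)


Definition eventually_bounded (d : R -> R) : Prop :=
  exists M S, forall s, S <= s -> Rabs (d s) <= M.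

(** (d e)' = e^2 + Q d^2 >= 0, so once d e is positive, d^2 grows at least linearly. *)
Lemma bounded_kernel_trivial (d e Q : R -> R) :
  (forall s, 0 <= s -> is_derive d s (e s)) ->
  (forall s, 0 <= s -> is_derive e s (Q s * d s)) ->
  (forall s, 0 <= s -> 0 <= Q s) -> d 0 = 0 -> eventually_bounded d ->
  forall s, 0 <= s -> d s = 0.
Proof.
  intros D1 D2 HQ d0 [M [S B]] s0 Hs0.
  destruct (Req_dec (d s0) 0) as [|ne]; [assumption|exfalso].
  assert (Ddd : forall s, 0 <= s -> is_derive (fun s => d s ^ 2) s (2 * (d s * e s))).
  { intros s Hs. specialize (D1 s Hs). auto_derive; [eexists; eassumption|].
    change (fun x => d x) with d. rewrite (is_derive_unique _ _ _ D1). ring. }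
  assert (s0pos : 0 < s0) by (destruct (Req_dec s0 0) as [->|]; [contradiction|lra]).
  destruct (mvt _ _ 0 s0 s0pos (fun s Hs => Ddd s (proj1 Hs))) as [c [Hc E]].
  simpl in E. rewrite d0 in E.
  assert (Pc : 0 < d c * e c).
  { assert (0 < d s0 ^ 2) by (apply pow2_gt_0; assumption). simpl in H. nra. }
  assert (Pmono : forall s, c <= s -> d c * e c <= d s * e s).
  { intros s Hs. apply (derive_nonneg_le (fun s => d s * e s) (fun s => e s ^ 2 + Q s * d s ^ 2)); [lra| |].
    - intros t Ht. specialize (D1 t ltac:(lra)). specialize (D2 t ltac:(lra)).
      auto_derive; [repeat split; eexists; eassumption|].
      change (fun x => d x) with d. change (fun x => e x) with e.
      rewrite (is_derive_unique _ _ _ D1), (is_derive_unique _ _ _ D2). ring.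
    - intros t Ht. specialize (HQ t ltac:(lra)).
      pose proof (pow2_ge_0 (e t)). pose proof (pow2_ge_0 (d t)). nra. }
  set (q := d c * e c) in *.
  set (b := Rmax S (c + (M ^ 2 + 1) / (2 * q))).
  assert (Hb1 : S <= b) by apply Rmax_l.
  assert (Hb2 : c + (M ^ 2 + 1) / (2 * q) <= b) by apply Rmax_r.
  assert (0 < (M ^ 2 + 1) / (2 * q)).
  { apply Rdiv_lt_0_compat; [pose proof (pow2_ge_0 M)|]; lra. }
  assert (Big : M ^ 2 + 1 <= d b ^ 2).
  { destruct (mvt (fun s => d s ^ 2) _ c b ltac:(lra) (fun s Hs => Ddd s ltac:(lra))) as [x [Hx Ex]].
    specialize (Pmono x ltac:(lra)). simpl in Ex. pose proof (pow2_ge_0 (d c)).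
    assert (2 * q * ((M ^ 2 + 1) / (2 * q)) <= 2 * (d x * e x) * (b - c)).
    { apply Rmult_le_compat; lra. }
    replace (2 * q * ((M ^ 2 + 1) / (2 * q))) with (M ^ 2 + 1) in H1 by (field; lra).
    simpl in *. lra. }
  specialize (B b Hb1). rewrite <- (pow2_abs (d b)) in Big.
  pose proof (Rabs_pos (d b)). nra.
Qed.

Lemma linear_ivp_unique (d e Q : R -> R) :
  (forall s, 0 <= s -> is_derive d s (e s)) ->
  (forall s, 0 <= s -> is_derive e s (Q s * d s)) ->
  (forall s, 0 <= s -> continuity_pt Q s) -> d 0 = 0 -> e 0 = 0 ->
  forall s, 0 <= s -> d s = 0.
Proof.
  intros D1 D2 CQ d0 e0 T HT.
  destruct (continuity_ab_maj (fun s => Rabs (Q s)) 0 T HT) as [p [Max Hp]].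
  { intros s Hs. apply (continuity_pt_comp Q Rabs); [apply CQ; lra|apply Rcontinuity_abs]. }
  pose proof (energy_bound d e (fun s => Q s * d s) (Rabs (Q p)) T (Rabs_pos _) HT) as B.
  rewrite d0, e0 in B.
  assert (d T ^ 2 + e T ^ 2 <= (0 ^ 2 + 0 ^ 2) * exp ((1 + Rabs (Q p)) * T)).
  { apply B.
    - intros; apply D1; lra.
    - intros; apply D2; lra.
    - intros s Hs. rewrite Rabs_mult. apply Rmult_le_compat_r; [apply Rabs_pos|now apply Max]. }
  pose proof (pow2_ge_0 (d T)). pose proof (pow2_ge_0 (e T)).
  apply Rsqr_0_uniq. unfold Rsqr. nra.
Qed.

(** A negative bounded d with d'' = Q d must have e >= 0, or concavity would send it to minus
    infinity; and it must tend to 0, or e would fall without bound. With e w >= 0 and d small, P >=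
    P a > 0 can only come from d w', so w' <= -1 eventually and w cannot stay positive. *)
Lemma decaying_tail_absurd (d e Q P w w' : R -> R) (k a b : R) :
  a <= b -> 0 <= k ->
  (forall s, b <= s -> is_derive d s (e s)) ->
  (forall s, b <= s -> is_derive e s (Q s * d s)) ->
  (forall s, b <= s -> is_derive w s (w' s)) ->
  (forall s, b <= s -> 1 <= Q s) -> (forall s, b <= s -> d s < 0) ->
  (forall s, b <= s -> 0 < w s) -> eventually_bounded d ->
  0 < P a -> (forall s, b <= s -> P a <= P s) ->
  (forall s, b <= s -> P s = d s * w' s - e s * w s - k * d s ^ 3) -> False.
Proof.
  intros Hab Hk D1 D2 Dw HQ Hd Hw [M [S B]] Pa PP PE.
  assert (edec : forall s t, b <= s <= t -> e t <= e s).
  { intros s t Hst. apply (derive_nonpos_le e (fun s => Q s * d s)); [lra| |].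
    - intros; apply D2; lra.
    - intros x Hx. specialize (HQ x ltac:(lra)). specialize (Hd x ltac:(lra)). nra. }
  assert (epos : forall s, b <= s -> 0 <= e s).
  { intros s Hs. destruct (Rle_lt_dec 0 (e s)) as [|N]; [assumption|exfalso].
    set (t := Rmax (s + 1) (Rmax S (s + (M + 1) / - e s))).
    assert (H1 : s + 1 <= t) by apply Rmax_l.
    assert (H2 : S <= t) by (eapply Rle_trans; [|apply Rmax_r]; apply Rmax_l).
    assert (H3 : s + (M + 1) / - e s <= t) by (eapply Rle_trans; [|apply Rmax_r]; apply Rmax_r).
    destruct (mvt d e s t) as [c [Hc E]]; [lra|intros; apply D1; lra|].
    specialize (edec s c ltac:(lra)). specialize (B t H2).
    pose proof (Hd s ltac:(lra)). pose proof (Hd t ltac:(lra)).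
    rewrite Rabs_left in B by assumption.
    assert ((M + 1) / - e s * - e s <= (t - s) * - e c).
    { apply Rmult_le_compat; try lra. apply Rmult_le_pos; [lra|]. left. apply Rinv_0_lt_compat; lra. }
    replace ((M + 1) / - e s * - e s) with (M + 1) in H4 by (field; lra). lra. }
  assert (dsmall : forall eps, 0 < eps -> exists T, b <= T /\ forall s, T <= s -> - eps < d s).
  { intros eps He. destruct (Rlt_le_dec (- eps) (d (b + (e b + 1) / eps))) as [L|N].
    - assert (0 <= (e b + 1) / eps) by (apply Rmult_le_pos;
        [specialize (epos b ltac:(lra)); lra|left; now apply Rinv_0_lt_compat]).
      exists (b + (e b + 1) / eps). split; [lra|]. intros s Hs.
      apply Rlt_le_trans with (1 := L). apply (derive_nonneg_le d e); [lra| |].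
      + intros; apply D1; lra.
      + intros; apply epos; lra.
    - exfalso. assert (0 < (e b + 1) / eps) by (apply Rdiv_lt_0_compat;
        [specialize (epos b ltac:(lra)); lra|assumption]).
      destruct (mvt e (fun s => Q s * d s) b (b + (e b + 1) / eps)) as [c [Hc E]];
        [lra|intros; apply D2; lra|].
      assert (d c <= - eps).
      { apply Rle_trans with (2 := N). apply (derive_nonneg_le d e); [lra| |].
        + intros; apply D1; lra.
        + intros; apply epos; lra. }
      specialize (HQ c ltac:(lra)). specialize (epos (b + (e b + 1) / eps) ltac:(lra)).
      assert (Q c * d c <= - eps) by nra.
      assert (Q c * d c * ((e b + 1) / eps) <= - eps * ((e b + 1) / eps))
        by (apply Rmult_le_compat_r; lra).
      replace (- eps * ((e b + 1) / eps)) with (- (e b + 1)) in H2 by (field; lra).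
      replace (b + (e b + 1) / eps - b) with ((e b + 1) / eps) in E by ring. lra. }
  set (p := P a) in *.
  (* For 0 < x = - d < eps: eps <= 1 gives k x^3 <= k x, and w' > -1 would give P <= (k + 1) x <
     p. *)
  set (eps := Rmin 1 (p / (k + 2))).
  assert (0 < p / (k + 2)) by (apply Rdiv_lt_0_compat; lra).
  assert (Heps : 0 < eps) by (apply Rmin_pos; lra).
  assert (eps1 : eps <= 1) by apply Rmin_l.
  assert (eps2 : eps * (k + 2) <= p).
  { apply Rle_trans with (p / (k + 2) * (k + 2)).
    - apply Rmult_le_compat_r; [lra|apply Rmin_r].
    - right. field. lra. }
  destruct (dsmall eps Heps) as [T [HT small]].
  assert (steep : forall s, T <= s -> w' s <= - 1).
  { intros s Hs. specialize (small s Hs). specialize (PP s ltac:(lra)). rewrite PE in PP by lra.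
    specialize (Hd s ltac:(lra)). specialize (epos s ltac:(lra)). specialize (Hw s ltac:(lra)).
    apply Rnot_lt_le. intros N.
    set (x := - d s). assert (0 < x < eps) by (unfold x; lra).
    replace (d s) with (- x) in PP by (unfold x; ring).
    assert (x ^ 3 <= x) by (assert (x * x <= 1) by nra; simpl; nra).
    assert (- x * w' s <= x) by nra.
    assert (0 <= e s * w s) by nra.
    assert (k * x ^ 3 <= k * x) by (apply Rmult_le_compat_l; lra).
    assert ((k + 1) * x < p) by nra.
    replace ((- x) ^ 3) with (- x ^ 3) in PP by ring. lra. }
  destruct (mvt w w' T (T + w T + 1)) as [c [Hc E]].
  - specialize (Hw T HT). lra.
  - intros; apply Dw; lra.
  - specialize (steep c ltac:(lra)). pose proof (Hw T HT). specialize (Hw (T + w T + 1) ltac:(lra)). nra.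
Qed.

(* Used with c = 1 for the difference of two solutions, and with c = 0, y1 = y2 for the
   linearized equation. *)
Section Rigidity.
Context (y1 v1 y2 v2 d e : R -> R) (c : R).
Context (H1 : connection y1 v1) (H2 : connection y2 v2) (Hc : 0 <= c).
Context (Vneg1 : v1 0 < 0) (Vneg2 : v2 0 < 0).
Context (Ey : forall s, 0 <= s -> y1 s - y2 s = c * d s).
Context (Ev : forall s, 0 <= s -> v1 s - v2 s = c * e s).
Context (Dd : forall s, 0 <= s -> is_derive d s (e s)).
Context (De : forall s, 0 <= s -> is_derive e s ((y1 s + y2 s) / 2 * d s)).
Context (d0 : d 0 = 0) (e0 : 0 < e 0) (Bd : eventually_bounded d).

Let q (s : R) : R := (y1 s + y2 s) / 2.
Let w (s : R) : R := (v1 s + v2 s) / 2.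
Let w' (s : R) : R := ((y1 s ^ 2 - s) / 2 + (y2 s ^ 2 - s) / 2) / 2.
Let N (s : R) : R := d s * w s - e s * q s.
Let P (s : R) : R := d s * w' s - e s * w s - c ^ 2 / 12 * d s ^ 3.

Lemma mean_flow (s : R) : 0 <= s -> is_derive q s (w s) /\ is_derive w s (w' s).
Proof.
  intros Hs. destruct (connection_flow _ _ H1 s Hs) as [A B].
  destruct (connection_flow _ _ H2 s Hs) as [C D]. unfold q, w, w'.
  split; (auto_derive; [repeat split; eexists; eassumption|]).
  - change (fun x => y1 x) with y1. change (fun x => y2 x) with y2.
    rewrite (is_derive_unique _ _ _ A), (is_derive_unique _ _ _ C). field.
  - change (fun x => v1 x) with v1. change (fun x => v2 x) with v2.
    rewrite (is_derive_unique _ _ _ B), (is_derive_unique _ _ _ D). field.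
Qed.

(** q'' - q^2 = - (y1 y2 + s) / 2, so N decreases while d > 0 and both solutions are negative. *)
Lemma wronskian_derive (s : R) : 0 <= s -> is_derive N s (- (d s * (y1 s * y2 s + s)) / 2).
Proof.
  intros Hs. destruct (mean_flow s Hs) as [A B]. specialize (Dd s Hs). specialize (De s Hs).
  unfold N. auto_derive; [repeat split; eexists; eassumption|].
  change (fun x => d x) with d. change (fun x => e x) with e.
  change (fun x => w x) with w. change (fun x => q x) with q.
  rewrite (is_derive_unique _ _ _ A), (is_derive_unique _ _ _ B),
    (is_derive_unique _ _ _ Dd), (is_derive_unique _ _ _ De).
  unfold w', q. field.
Qed.

(* The defect w'' - q w = c^2 d e / 4 - 1/2 is a constant plus a total derivative after
   multiplication by d, which the cubic term absorbs. *)
Lemma corrected_wronskian_derive (s : R) : 0 <= s -> is_derive P s (- d s / 2).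
Proof.
  intros Hs. destruct (mean_flow s Hs) as [A B].
  destruct (connection_flow _ _ H1 s Hs) as [A1 _].
  destruct (connection_flow _ _ H2 s Hs) as [A2 _].
  pose proof (Dd s Hs) as D1. pose proof (De s Hs) as D2.
  unfold P, w'. auto_derive; [repeat split; eexists; eassumption|].
  change (fun x => d x) with d. change (fun x => e x) with e.
  change (fun x => w x) with w. change (fun x => y1 x) with y1. change (fun x => y2 x) with y2.
  rewrite (is_derive_unique _ _ _ B),
    (is_derive_unique _ _ _ D1), (is_derive_unique _ _ _ D2),
    (is_derive_unique _ _ _ A1), (is_derive_unique _ _ _ A2).
  unfold w'.
  replace (v1 s) with (w s + c * e s / 2) by (unfold w; rewrite <- Ev by assumption; field).
  replace (v2 s) with (w s - c * e s / 2) by (unfold w; rewrite <- Ev by assumption; field).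
  replace (y1 s) with (q s + c * d s / 2) by (unfold q; rewrite <- Ey by assumption; field).
  replace (y2 s) with (q s - c * d s / 2) by (unfold q; rewrite <- Ey by assumption; field).
  field.
Qed.

Lemma d_continuity (s : R) : 0 <= s -> continuity_pt d s.
Proof. intros Hs. now apply derive_continuity_pt with (e s), Dd. Qed.

Lemma d_initially_pos : exists del, 0 < del /\ forall t, 0 < t < del -> 0 < d t.
Proof.
  destruct (derive_pos_right d 0 (e 0) (Dd 0 ltac:(lra)) e0) as [del [H Q]].
  exists del. split; [assumption|]. intros t Ht. rewrite <- d0. apply Q. lra.
Qed.

(* At the first zero of y1, positivity of d would force N = d v1 > 0. *)
Lemma first_zero_of_difference :
  exists z, 0 < z /\ (forall s, 0 < s < z -> 0 < d s) /\ d z = 0 /\ e z < 0 /\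
    (forall s, 0 < s < z -> y1 s < 0).
Proof.
  destruct (connection_turning_point y1 v1 H1 Vneg1) as [m [Hm [Vm [_ [Vpos Ym]]]]].
  destruct (connection_unbounded y1 v1 H1 0) as [S [_ HS]].
  assert (0 < sqrt m) by now apply sqrt_lt_R0.
  destruct (first_zero (fun s => - y1 s) m (Rmax S (m + 1))) as [s1 [Hs1 [Z1 P1]]].
  { pose proof (Rmax_r S (m + 1)). lra. }
  { intros s Hs. apply continuity_pt_opp, derive_continuity_pt with (v1 s).
    apply (connection_derive y1 v1 H1). lra. }
  { lra. }
  { specialize (HS (Rmax S (m + 1)) (Rmax_l _ _)). lra. }
  assert (Z : y1 s1 = 0) by lra. clear Z1.
  assert (Yneg : forall s, 0 < s < s1 -> y1 s < 0).
  { intros s Hs. destruct (Rlt_le_dec s m) as [L|G].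
    - rewrite <- (connection_0 y1 v1 H1). apply (derive_neg_lt y1 v1); [lra| |].
      + intros; apply (connection_derive y1 v1 H1); lra.
      + intros; apply Vm; lra.
    - specialize (P1 s ltac:(lra)). lra. }
  assert (Nneg : forall t, 0 < t <= s1 -> (forall s, 0 < s < t -> 0 < d s) -> N t < 0).
  { intros t Ht Pd. replace 0 with (N 0).
    2: { unfold N, q. rewrite d0, (connection_0 _ _ H1), (connection_0 _ _ H2). field. }
    apply (derive_neg_lt N (fun s => - (d s * (y1 s * y2 s + s)) / 2)); [lra| |].
    - intros s Hs. apply wronskian_derive; lra.
    - intros s Hs. specialize (Pd s Hs). specialize (Yneg s ltac:(lra)).
      specialize (Ey s ltac:(lra)). assert (0 <= c * d s) by nra.
      assert (y2 s < 0) by lra. assert (0 < y1 s * y2 s) by nra. nra. }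
  destruct d_initially_pos as [del [Hdel Q]].
  (* The search for the zero starts at a > 0, because d vanishes at 0 itself. *)
  set (a := Rmin (del / 2) (s1 / 2)).
  assert (0 < a /\ a < del /\ a < s1) as [Ha1 [Ha2 Ha3]].
  { unfold a, Rmin. destruct (Rle_dec (del / 2) (s1 / 2)); lra. }
  assert (Pa : forall s, 0 < s <= a -> 0 < d s) by (intros; apply Q; lra).
  assert (Ex : exists t, a < t <= s1 /\ d t <= 0).
  { destruct (Rle_lt_dec (d s1) 0) as [L|G]; [exists s1; split; [lra|assumption]|].
    apply Classical_Prop.NNPP. intros No.
    assert (All : forall s, 0 < s < s1 -> 0 < d s).
    { intros s Hs. destruct (Rle_lt_dec s a); [apply Pa; lra|].
      apply Rnot_le_lt. intros L. apply No. exists s. split; lra. }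
    specialize (Nneg s1 ltac:(lra) All). unfold N, q, w in Nneg.
    pose proof (Ey s1 ltac:(lra)) as E1. pose proof (Ev s1 ltac:(lra)) as E2. rewrite Z in *.
    specialize (Vpos s1 ltac:(lra)).
    replace (y2 s1) with (- (c * d s1)) in Nneg by lra.
    replace (v2 s1) with (v1 s1 - c * e s1) in Nneg by lra. nra. }
  destruct Ex as [t [Ht Nt]].
  destruct (first_zero d a t) as [z [Hz [Z0 Pz]]]; [lra|intros; apply d_continuity; lra|apply Pa; lra|assumption|].
  assert (All : forall s, 0 < s < z -> 0 < d s).
  { intros s Hs. destruct (Rle_lt_dec s a); [apply Pa; lra|apply Pz; lra]. }
  exists z. split; [lra|split; [assumption|split; [assumption|split]]].
  (* As d z = 0, the solutions agree at z and N z = - e z * y1 z < 0 with y1 z <= 0; hence e z <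
     0. *)
  - specialize (Nneg z ltac:(lra) All). unfold N, q in Nneg. rewrite Z0 in Nneg.
    assert (Y : y1 z <= 0) by (destruct (Req_dec z s1) as [->|]; [lra|left; apply Yneg; lra]).
    specialize (Ey z ltac:(lra)). rewrite Z0 in Ey. nra.
  - intros s Hs. apply Yneg. lra.
Qed.

Lemma rigidity : False.
Proof.
  destruct first_zero_of_difference as [z [Hz [dpos [dz [ez Yneg]]]]].
  destruct (connection_turning_point y1 v1 H1 Vneg1) as [m [Hm [Vm [Vm0 [Vpos Ym]]]]].
  assert (early : m ^ 2 < 4 * - v1 0).
  { apply (turning_point_early y1 v1); auto. apply H1. }
  assert (elin : forall s, 0 <= s <= z -> e s <= e 0).
  { intros s Hs. apply (derive_nonpos_le e (fun s => (y1 s + y2 s) / 2 * d s)); [lra| |].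
    - intros; apply De; lra.
    - intros t Ht. destruct (Req_dec t 0) as [->|]; [rewrite d0; lra|].
      destruct (Req_dec t z) as [->|]; [rewrite dz; lra|].
      specialize (dpos t ltac:(lra)). specialize (Yneg t ltac:(lra)). specialize (Ey t ltac:(lra)).
      assert (0 <= c * d t) by nra. nra. }
  assert (dlin : forall s, 0 <= s <= z -> d s <= e 0 * s).
  { intros s Hs. assert (d s - e 0 * s <= d 0 - e 0 * 0); [|rewrite d0 in *; lra].
    apply (derive_nonpos_le (fun s => d s - e 0 * s) (fun s => e s - e 0)); [lra| |].
    - intros t Ht. pose proof (Dd t ltac:(lra)) as D1. auto_derive; [eexists; eassumption|].
      change (fun x => d x) with d. rewrite (is_derive_unique _ _ _ D1). ring.
    - intros t Ht. specialize (elin t ltac:(lra)). lra. }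
  (* P' = - d / 2 >= - e(0) s / 2 is integrated from P 0 = - e(0) w(0) to P z = - e(z) w(z). *)
  assert (Pz : - e z * w z >= e 0 * (- w 0 - z ^ 2 / 4)).
  { assert (P 0 + e 0 * 0 ^ 2 / 4 <= P z + e 0 * z ^ 2 / 4).
    { apply (derive_nonneg_le (fun s => P s + e 0 * s ^ 2 / 4) (fun s => - d s / 2 + e 0 * s / 2)); [lra| |].
      - intros t Ht. pose proof (corrected_wronskian_derive t ltac:(lra)) as D1.
        auto_derive; [eexists; eassumption|].
        change (fun x => P x) with P. rewrite (is_derive_unique _ _ _ D1). field.
      - intros t Ht. specialize (dlin t Ht). lra. }
    unfold P in H. rewrite d0, dz in H. lra. }
  (* If w z <= 0, then v1 z <= 0 because e z < 0, so z <= m. As v2 0 <= v1 0, also - w 0 >= - v1 0 >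
     m^2/4 >= z^2/4, and [Pz] makes w z positive after all. *)
  assert (wz : 0 < w z).
  { apply Rnot_le_lt. intros L.
    assert (v1 z <= 0).
    { unfold w in L. specialize (Ev z ltac:(lra)). assert (c * e z <= 0) by nra. lra. }
    assert (z <= m) by (apply Rnot_lt_le; intros G; specialize (Vpos z G); lra).
    assert (z ^ 2 <= m ^ 2) by (apply pow_incr; lra).
    assert (v2 0 <= v1 0).
    { specialize (Ev 0 ltac:(lra)). assert (0 <= c * e 0) by nra. lra. }
    assert (0 < - w 0 - z ^ 2 / 4) by (unfold w; lra). nra. }
  assert (Ppos : 0 < P z) by (unfold P; rewrite dz; nra).
  (* v2 z = w z - c e z / 2 >= w z > 0, so y2 increases beyond z. *)
  assert (V2 : forall s, z <= s -> 0 < v2 s).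
  { intros s Hs. apply (connection_stays_increasing y2 v2 H2 z); [lra|].
    specialize (Ev z ltac:(lra)). unfold w in wz. assert (c * e z <= 0) by nra. lra. }
  assert (Pmono : forall s, z <= s -> (forall t, z < t < s -> d t < 0) -> P z <= P s).
  { intros s Hs Neg. destruct (Req_dec z s) as [->|]; [lra|].
    left. apply (derive_pos_lt P (fun s => - d s / 2)); [lra| |].
    - intros t Ht. apply corrected_wronskian_derive; lra.
    - intros t Ht. specialize (Neg t Ht). lra. }
  destruct (derive_neg_right d z (e z) (Dd z ltac:(lra)) ez) as [del [Hdel Q]].
  rewrite dz in Q.
  assert (Neg : forall t, z < t -> d t < 0).
  { intros t Ht. apply Rnot_le_lt. intros L.
    set (a := Rmin (z + del / 2) ((z + t) / 2)).
    assert (z < a /\ a < z + del /\ a < t) as [Ha1 [Ha2 Ha3]].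
    { unfold a, Rmin. destruct (Rle_dec (z + del / 2) ((z + t) / 2)); lra. }
    destruct (first_zero (fun s => - d s) a t) as [x [Hx [Zx Px]]].
    - lra.
    - intros; apply continuity_pt_opp, d_continuity; lra.
    - specialize (Q a ltac:(lra)). lra.
    - lra.
    - assert (NegX : forall s, z < s < x -> d s < 0).
      { intros s Hs. destruct (Rlt_le_dec s a) as [G|G]; [apply Q; lra|].
        specialize (Px s ltac:(lra)). lra. }
      assert (dx : d x = 0) by lra.
      assert (ex : 0 <= e x).
      { assert (- e x <= 0); [|lra].
        apply (first_zero_derive (fun s => - d s) z x); [lra| |lra|].
        - intros s Hs. specialize (NegX s Hs). lra.
        - apply (is_derive_opp d), Dd. lra. }
      (* At a second zero x, P x = - e x * w x with e x >= 0 and w x = v2 x + c e x / 2 > 0; so P x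
         <= 0 < P z <= P x. *)
      specialize (Pmono x ltac:(lra) NegX). unfold P at 2 in Pmono. rewrite dx in Pmono.
      specialize (V2 x ltac:(lra)). specialize (Ev x ltac:(lra)).
      assert (0 <= c * e x) by nra. assert (0 < w x) by (unfold w; lra). nra. }
  destruct (connection_eventually y1 v1 H1) as [S1 [S1p HS1]].
  destruct (connection_eventually y2 v2 H2) as [S2 [S2p HS2]].
  set (b := Rmax (z + 1) (Rmax S1 S2)).
  assert (B1 : z + 1 <= b) by apply Rmax_l.
  assert (B2 : S1 <= b) by (eapply Rle_trans; [|apply Rmax_r]; apply Rmax_l).
  assert (B3 : S2 <= b) by (eapply Rle_trans; [|apply Rmax_r]; apply Rmax_r).
  apply (decaying_tail_absurd d e q P w w' (c ^ 2 / 12) z b); try lra; try assumption.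
  - pose proof (pow2_ge_0 c). lra.
  - intros; apply Dd; lra.
  - intros; apply De; lra.
  - intros; apply mean_flow; lra.
  - intros s Hs. destruct (HS1 s ltac:(lra)), (HS2 s ltac:(lra)). unfold q. lra.
  - intros; apply Neg; lra.
  - intros s Hs. destruct (HS1 s ltac:(lra)), (HS2 s ltac:(lra)). unfold w. lra.
  - intros s Hs. apply Pmono; [lra|]. intros; apply Neg; lra.
  - reflexivity.
Qed.

End Rigidity.

(** * Solutions on the half line *)


Lemma D_in_half_line_derive (f f' : R -> R) (s : R) :
  0 < s -> D_in f f' half_line s -> is_derive f s (f' s).
Proof.
  intros Hs H. apply is_derive_Reals. intros eps He.
  destruct (H eps He) as [del [Hd P]].
  assert (Hm : 0 < Rmin del s) by now apply Rmin_pos.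
  exists (mkposreal _ Hm). intros h Hh0 Hh. simpl in Hh.
  pose proof (Rmin_l del s). pose proof (Rmin_r del s).
  specialize (P (s + h)). simpl in P. unfold Rdist in P.
  replace (s + h - s) with h in P by ring. apply P.
  apply Rabs_def2 in Hh as Hh'. unfold D_x, half_line. split; [split; lra|lra].
Qed.

Lemma derive_D_in_half_line (f f' : R -> R) (s : R) :
  is_derive f s (f' s) -> D_in f f' half_line s.
Proof.
  intros H. apply is_derive_Reals in H. intros eps He.
  destruct (H eps He) as [del P]. exists del. split; [apply cond_pos|].
  intros x [[_ ne] Hx]. simpl in *. unfold Rdist in *.
  specialize (P (x - s) ltac:(lra) Hx). now replace (s + (x - s)) with x in P by ring.
Qed.

(** [Rmax 0] is 1-Lipschitz and maps into the half line; composing with it replaces the arbitrary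
    values left of 0 by the constant f 0. *)
Lemma continuity_clamp (f : R -> R) :
  (forall s, half_line s -> continue_in f half_line s) ->
  continuity (fun s => f (Rmax 0 s)).
Proof.
  intros C s eps He.
  assert (Lip : forall t, Rabs (Rmax 0 t - Rmax 0 s) <= Rabs (t - s)).
  { intros t. unfold Rmax. destruct (Rle_dec 0 t), (Rle_dec 0 s);
      unfold Rabs; repeat destruct Rcase_abs; lra. }
  destruct (C (Rmax 0 s) (Rmax_l 0 s) eps He) as [del [Hd P]].
  exists del. split; [assumption|]. intros x [_ Hx]. simpl in *. unfold Rdist in *.
  destruct (Req_dec (Rmax 0 x) (Rmax 0 s)) as [->|ne].
  - rewrite Rminus_diag, Rabs_R0; assumption.
  - apply P. split; [split; [apply Rmax_l|now apply not_eq_sym]|].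
    apply Rle_lt_trans with (2 := Hx). apply Lip.
Qed.

Definition primitive (g : R -> R) (s : R) : R := RInt g 0 s.

Lemma primitive_0 (g : R -> R) : primitive g 0 = 0.
Proof. unfold primitive. now rewrite RInt_point. Qed.

Lemma primitive_derive (g : R -> R) (s : R) :
  continuity g -> is_derive (primitive g) s (g s).
Proof.
  intros C. unfold primitive.
  assert (C' : forall x, continuous g x) by (intros x; apply continuity_pt_filterlim, C).
  apply (is_derive_RInt g (fun b => RInt g 0 b) 0 s); [|apply C'].
  exists (mkposreal 1 Rlt_0_1). intros t _. apply (RInt_correct g).
  apply (ex_RInt_continuous g). intros; apply C'.
Qed.

Lemma primitive_continuity (g : R -> R) : continuity g -> continuity (primitive g).
Proof. intros C s. apply derive_continuity_pt with (g s), primitive_derive, C. Qed.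

Lemma derive_eq_const (f g h : R -> R) :
  (forall s, 0 < s -> is_derive f s (h s)) -> (forall s, 0 < s -> is_derive g s (h s)) ->
  exists c, forall s, 0 < s -> f s = c + g s.
Proof.
  intros Df Dg. exists (f 1 - g 1).
  assert (D : forall s, 0 < s -> is_derive (fun t => f t - g t) s 0).
  { intros s Hs. replace 0 with (h s - h s) by ring.
    apply (is_derive_minus f g); auto. }
  intros s Hs. enough (f s - g s = f 1 - g 1) by lra.
  destruct (Rtotal_order s 1) as [L|[->|G]]; [|reflexivity|].
  - destruct (mvt (fun t => f t - g t) (fun _ => 0) s 1 L) as [c [_ E]]; [intros; apply D; lra|lra].
  - destruct (mvt (fun t => f t - g t) (fun _ => 0) 1 s G) as [c [_ E]]; [intros; apply D; lra|lra].
Qed.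

(* [y] and [y'] themselves will not do: their values left of 0 are arbitrary. *)
Lemma two_sided_extension (y y' g : R -> R) :
  continuity g -> (forall s, half_line s -> continue_in y half_line s) ->
  (forall s, 0 < s -> is_derive y s (y' s)) ->
  (forall s, 0 < s -> is_derive y' s (g s)) ->
  exists Y V, (forall s, is_derive Y s (V s)) /\ (forall s, is_derive V s (g s)) /\
    (forall s, 0 <= s -> Y s = y s).
Proof.
  intros Cg Cy D1 D2.
  destruct (derive_eq_const y' (primitive g) g D2) as [a Ha].
  { intros; now apply primitive_derive. }
  set (V := fun s => a + primitive g s).
  assert (CV : continuity V).
  { apply continuity_plus; [apply continuity_const; now intros ? ?|now apply primitive_continuity]. }
  assert (DV : forall s, is_derive V s (g s)).
  { intros s. replace (g s) with (0 + g s) by ring.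
    apply (is_derive_plus (fun _ => a)); [apply (is_derive_const a)|now apply primitive_derive]. }
  destruct (derive_eq_const y (primitive V) y' D1) as [b Hb].
  { intros s Hs. rewrite Ha by assumption. now apply (primitive_derive V). }
  assert (Db : forall s, is_derive (fun s => b + primitive V s) s (V s)).
  { intros s. replace (V s) with (0 + V s) by ring.
    apply (is_derive_plus (fun _ => b)); [apply (is_derive_const b)|now apply primitive_derive]. }
  exists (fun s => b + primitive V s), V. split; [exact Db|split; [exact DV|]].
  intros s [Hs|<-]; [now rewrite Hb|].
  (* The two functions are known to agree only for s > 0; continuity of h carries this to 0. *)
  set (h := fun s => (b + primitive V s) - y (Rmax 0 s)).
  assert (Ch : continuity_pt h 0).
  { apply (continuity_pt_minus (fun s => b + primitive V s)).
    - apply derive_continuity_pt with (V 0), Db.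
    - apply (continuity_clamp y Cy). }
  assert (h0 : h 0 = 0).
  { destruct (Req_dec (h 0) 0) as [|ne]; [assumption|exfalso].
    destruct (continuity_pt_eps h 0 Ch (Rabs (h 0))) as [d [Hd P]]; [now apply Rabs_pos_lt|].
    specialize (P (d / 2)). rewrite Rabs_pos_eq in P by lra. specialize (P ltac:(lra)).
    replace (h (d / 2)) with 0 in P.
    - rewrite Rminus_0_l, Rabs_Ropp in P. lra.
    - unfold h. rewrite Rmax_right by lra. rewrite (Hb (d / 2)) by lra. ring. }
  unfold h in h0. rewrite Rmax_left in h0 by lra. lra.
Qed.

Lemma derive_continue_in (f : R -> R) (s l : R) :
  is_derive f s l -> continue_in f half_line s.
Proof.
  intros H eps He. destruct (continuity_pt_eps f s (derive_continuity_pt f s l H) eps He) as [d [Hd P]].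
  exists d. split; [assumption|]. intros x [_ Hx]. now apply P.
Qed.

Lemma bvp_solution_connection (y : R -> R) :
  bvp_solution y -> exists Y V, connection Y V /\ eq_on_half_line y Y.
Proof.
  intros [Cy [[y' [y'' D]] [y0 lim]]].
  (* The right-hand side is evaluated along the given y and clamped; integrating it twice recovers y
     with two-sided derivatives. *)
  set (g := fun s => (y (Rmax 0 s) ^ 2 - Rmax 0 s) / 2).
  assert (Cg : continuity g).
  { assert (C1 : continuity (fun s => y (Rmax 0 s))) by now apply continuity_clamp.
    assert (C2 : continuity (fun s => Rmax 0 s)).
    { apply (continuity_clamp (fun s => s)). intros s _. apply derive_continue_in with 1, (is_derive_id s). }
    assert (C : continuity (fun s => (y (Rmax 0 s) ^ 2 - Rmax 0 s) * / 2)); [|exact C].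
    apply (continuity_mult (fun s => y (Rmax 0 s) ^ 2 - Rmax 0 s) (fun _ => / 2)).
    - apply (continuity_minus (fun s => y (Rmax 0 s) ^ 2)); [|exact C2].
      apply (continuity_comp (fun s => y (Rmax 0 s)) (fun z => z ^ 2)); [exact C1|].
      intros x. apply derivable_continuous_pt, derivable_pt_pow.
    - apply continuity_const. now intros ? ?. }
  destruct (two_sided_extension y y' g Cg Cy) as [Y [V [D1 [D2 E]]]].
  - intros s Hs. apply D_in_half_line_derive; [assumption|apply D, Hs].
  - intros s Hs. destruct (D s Hs) as [_ [D2 E]].
    replace (g s) with (y'' s); [now apply D_in_half_line_derive|].
    unfold g. rewrite Rmax_right; lra.
  - exists Y, V. split; [split; [split|]|].
    + rewrite E; lra.
    + intros s Hs. split; [apply D1|]. replace ((Y s ^ 2 - s) / 2) with (g s); [apply D2|].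
      unfold g. rewrite Rmax_right, E by lra. reflexivity.
    + apply is_lim_ext_loc with (2 := lim). exists 0. intros s Hs. rewrite E; [reflexivity|lra].
    + intros s Hs. now rewrite E.
Qed.

Lemma connection_bvp_solution (y v : R -> R) : connection y v -> bvp_solution y.
Proof.
  intros Hc. split; [|split; [|split]].
  - intros s Hs. now apply derive_continue_in with (v s), (connection_derive y v Hc).
  - exists v, (fun s => (y s ^ 2 - s) / 2). intros s Hs.
    destruct (connection_flow y v Hc s ltac:(lra)) as [D1 D2].
    split; [now apply derive_D_in_half_line|split; [now apply derive_D_in_half_line|field]].
  - apply Hc.
  - apply Hc.
Qed.

(** * Uniqueness and nondegeneracy of the two branches *)

Lemma connection_difference_bounded (y1 v1 y2 v2 : R -> R) :
  connection y1 v1 -> connection y2 v2 -> eventually_bounded (fun s => y1 s - y2 s).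
Proof.
  intros H1 H2.
  destruct (connection_near_sqrt y1 v1 H1 1 Rlt_0_1) as [S1 [L1 N1]].
  destruct (connection_near_sqrt y2 v2 H2 1 Rlt_0_1) as [S2 [L2 N2]].
  exists 1, (Rmax S1 S2). intros s Hs.
  pose proof (Rmax_l S1 S2). pose proof (Rmax_r S1 S2).
  specialize (N1 s ltac:(lra)). specialize (N2 s ltac:(lra)).
  pose proof (connection_lt_sqrt y1 v1 H1 s ltac:(lra)).
  pose proof (connection_lt_sqrt y2 v2 H2 s ltac:(lra)).
  apply Rabs_le. lra.
Qed.

Lemma difference_flow (y1 v1 y2 v2 : R -> R) (s : R) :
  flow y1 v1 s -> flow y2 v2 s ->
  is_derive (fun t => y1 t - y2 t) s (v1 s - v2 s) /\
  is_derive (fun t => v1 t - v2 t) s ((y1 s + y2 s) / 2 * (y1 s - y2 s)).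
Proof.
  intros [A B] [C D]. split; [now apply (is_derive_minus y1 y2)|].
  replace ((y1 s + y2 s) / 2 * (y1 s - y2 s)) with ((y1 s ^ 2 - s) / 2 - (y2 s ^ 2 - s) / 2) by field.
  now apply (is_derive_minus v1 v2).
Qed.

Lemma connection_increasing_nonneg (y v : R -> R) (s : R) :
  connection y v -> 0 < v 0 -> 0 <= s -> 0 <= y s.
Proof.
  intros Hc V0 Hs. rewrite <- (connection_0 y v Hc).
  apply (derive_nonneg_le y v); [assumption| |].
  - intros; apply (connection_derive y v Hc); lra.
  - intros t Ht. left. apply (connection_stays_increasing y v Hc 0); [lra|assumption].
Qed.

Lemma increasing_connection_unique (y1 v1 y2 v2 : R -> R) :
  connection y1 v1 -> connection y2 v2 -> 0 < v1 0 -> 0 < v2 0 ->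
  forall s, 0 <= s -> y1 s = y2 s.
Proof.
  intros H1 H2 P1 P2 s Hs. apply Rminus_diag_uniq.
  apply (bounded_kernel_trivial (fun s => y1 s - y2 s) (fun s => v1 s - v2 s)
    (fun s => (y1 s + y2 s) / 2)).
  - intros; apply difference_flow; now apply connection_flow.
  - intros; apply difference_flow; now apply connection_flow.
  - intros t Ht. pose proof (connection_increasing_nonneg y1 v1 t H1 P1 Ht).
    pose proof (connection_increasing_nonneg y2 v2 t H2 P2 Ht). lra.
  - rewrite (connection_0 y1 v1 H1), (connection_0 y2 v2 H2). ring.
  - now apply connection_difference_bounded with v1 v2.
  - assumption.
Qed.

(** [rigidity] excludes only a difference that starts upwards. Exchanging the two solutions gives
    equality of slopes, after which uniqueness for the initial value problem applies. *)
Lemma decreasing_connection_slope_unique (y1 v1 y2 v2 : R -> R) :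
  connection y1 v1 -> connection y2 v2 -> v1 0 < 0 -> v2 0 < 0 -> v1 0 <= v2 0.
Proof.
  intros H1 H2 N1 N2. apply Rnot_lt_le. intros L.
  apply (rigidity y1 v1 y2 v2 (fun s => y1 s - y2 s) (fun s => v1 s - v2 s) 1); auto; try lra.
  - intros; ring.
  - intros; ring.
  - intros; apply difference_flow; now apply connection_flow.
  - intros; apply difference_flow; now apply connection_flow.
  - rewrite (connection_0 y1 v1 H1), (connection_0 y2 v2 H2). ring.
  - now apply connection_difference_bounded with v1 v2.
Qed.

Lemma decreasing_connection_unique (y1 v1 y2 v2 : R -> R) :
  connection y1 v1 -> connection y2 v2 -> v1 0 < 0 -> v2 0 < 0 ->
  forall s, 0 <= s -> y1 s = y2 s.
Proof.
  intros H1 H2 N1 N2 s Hs. apply Rminus_diag_uniq.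
  apply (linear_ivp_unique (fun s => y1 s - y2 s) (fun s => v1 s - v2 s)
    (fun s => (y1 s + y2 s) / 2)).
  - intros; apply difference_flow; now apply connection_flow.
  - intros; apply difference_flow; now apply connection_flow.
  - intros t Ht. destruct (connection_flow y1 v1 H1 t Ht) as [A _].
    destruct (connection_flow y2 v2 H2 t Ht) as [B _].
    apply derive_continuity_pt with ((v1 t + v2 t) / 2).
    auto_derive; [repeat split; eexists; eassumption|].
    change (fun x => y1 x) with y1. change (fun x => y2 x) with y2.
    rewrite (is_derive_unique _ _ _ A), (is_derive_unique _ _ _ B). field.
  - rewrite (connection_0 y1 v1 H1), (connection_0 y2 v2 H2). ring.
  - pose proof (decreasing_connection_slope_unique y1 v1 y2 v2 H1 H2 N1 N2).
    pose proof (decreasing_connection_slope_unique y2 v2 y1 v1 H2 H1 N2 N1). lra.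
  - assumption.
Qed.

Lemma connection_continuity (y v : R -> R) (s : R) :
  connection y v -> 0 <= s -> continuity_pt y s.
Proof. intros Hc Hs. now apply derive_continuity_pt with (v s), (connection_derive y v Hc). Qed.

Lemma linearized_solution_extension (y v psi : R -> R) :
  connection y v -> linearized_solution y psi ->
  exists d e, (forall s, 0 <= s -> is_derive d s (e s)) /\
    (forall s, 0 <= s -> is_derive e s (y s * d s)) /\
    (forall s, 0 <= s -> d s = psi s) /\ d 0 = 0.
Proof.
  intros Hc [[psi' [psi'' D]] psi0].
  assert (Cpsi : forall s, half_line s -> continue_in psi half_line s).
  { intros s Hs. apply (cont_deriv psi psi' half_line s). apply D, Hs. }
  assert (Cy : forall s, half_line s -> continue_in y half_line s).
  { intros s Hs. now apply derive_continue_in with (v s), (connection_derive y v Hc). }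
  set (g := fun s => y (Rmax 0 s) * psi (Rmax 0 s)).
  destruct (two_sided_extension psi psi' g) as [d [e [D1 [D2 E]]]].
  - apply (continuity_mult (fun s => y (Rmax 0 s))); now apply continuity_clamp.
  - exact Cpsi.
  - intros s Hs. apply D_in_half_line_derive; [assumption|apply D; unfold half_line; lra].
  - intros s Hs. destruct (D s ltac:(unfold half_line; lra)) as [_ [D2 E]].
    replace (g s) with (psi'' s); [now apply D_in_half_line_derive|].
    unfold g. rewrite Rmax_right; lra.
  - exists d, e. split; [intros; apply D1|split; [|split; [exact E|rewrite E; lra]]].
    intros s Hs. replace (y s * d s) with (g s); [apply D2|].
    unfold g. rewrite Rmax_right, E by lra. reflexivity.
Qed.

Lemma bounded_eventually (d psi : R -> R) :
  bounded_on_half_line psi -> (forall s, 0 <= s -> d s = psi s) -> eventually_bounded d.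
Proof.
  intros [M B] E. exists M, 0. intros s Hs. rewrite E by assumption. now apply B.
Qed.

Lemma increasing_connection_nondegenerate (y v : R -> R) :
  connection y v -> 0 < v 0 -> nondegenerate y.
Proof.
  intros Hc V0 [psi [_ [B [L nz]]]].
  destruct (linearized_solution_extension y v psi Hc L) as [d [e [D1 [D2 [E d0]]]]].
  apply nz. intros s Hs. rewrite <- E by assumption.
  apply (bounded_kernel_trivial d e y); auto.
  - intros; now apply connection_increasing_nonneg with v.
  - now apply bounded_eventually with psi.
Qed.

(** The case c = 0 of [rigidity]; applied to a kernel element and to its negative, it forces the
    initial slope to vanish. *)
Lemma bounded_kernel_slope_nonpos (y v d e : R -> R) :
  connection y v -> v 0 < 0 ->
  (forall s, 0 <= s -> is_derive d s (e s)) ->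
  (forall s, 0 <= s -> is_derive e s (y s * d s)) ->
  d 0 = 0 -> eventually_bounded d -> e 0 <= 0.
Proof.
  intros Hc V0 D1 D2 d0 B. apply Rnot_lt_le. intros L.
  apply (rigidity y v y v d e 0); auto; try lra.
  - intros; ring.
  - intros; ring.
  - intros s Hs. replace ((y s + y s) / 2) with (y s) by field. now apply D2.
Qed.

Lemma decreasing_connection_nondegenerate (y v : R -> R) :
  connection y v -> v 0 < 0 -> nondegenerate y.
Proof.
  intros Hc V0 [psi [_ [B [L nz]]]].
  destruct (linearized_solution_extension y v psi Hc L) as [d [e [D1 [D2 [E d0]]]]].
  assert (Bd : eventually_bounded d) by now apply bounded_eventually with psi.
  apply nz. intros s Hs. rewrite <- E by assumption.
  apply (linear_ivp_unique d e y); auto.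
  - intros; now apply connection_continuity with v.
  - apply Rle_antisym; [now apply (bounded_kernel_slope_nonpos y v d e)|].
    assert (- e 0 <= 0); [|lra].
    apply (bounded_kernel_slope_nonpos y v (fun s => - d s) (fun s => - e s)); auto.
    + intros. now apply (is_derive_opp d), D1.
    + intros t Ht. replace (y t * - d t) with (- (y t * d t)) by ring. now apply (is_derive_opp e), D2.
    + lra.
    + destruct Bd as [M [S HM]]. exists M, S. intros t Ht. rewrite Rabs_Ropp. now apply HM.
Qed.

(** * Picard iteration *)


(** Integration against the weight exp (k s) gains a factor 1/k, which is the source of the
    contraction below. *)
Lemma exp_growth_bound (h h' : R -> R) (k B T : R) :
  0 <= T -> (forall s, 0 <= s <= T -> is_derive h s (h' s)) ->
  (forall s, 0 <= s <= T -> Rabs (h' s) <= k * B * exp (k * s)) ->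
  h 0 = 0 -> 0 <= B -> Rabs (h T) <= B * exp (k * T).
Proof.
  intros HT D Bd h0 HB.
  assert (DE : forall s, is_derive (fun s => B * exp (k * s)) s (k * B * exp (k * s))).
  { intros s. auto_derive; [exact I|ring]. }
  assert (U : h T - B * exp (k * T) <= h 0 - B * exp (k * 0)).
  { apply (derive_nonpos_le (fun s => h s - B * exp (k * s)) (fun s => h' s - k * B * exp (k * s))); [assumption| |].
    - intros s Hs. apply (is_derive_minus h); auto.
    - intros s Hs. specialize (Bd s Hs). pose proof (Rle_abs (h' s)). lra. }
  assert (V : h 0 + B * exp (k * 0) <= h T + B * exp (k * T)).
  { apply (derive_nonneg_le (fun s => h s + B * exp (k * s)) (fun s => h' s + k * B * exp (k * s))); [assumption| |].
    - intros s Hs. apply (is_derive_plus h); auto.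
    - intros s Hs. specialize (Bd s Hs). pose proof (Rle_abs (- h' s)). rewrite Rabs_Ropp in H. lra. }
  rewrite h0, Rmult_0_r, exp_0 in *. apply Rabs_le. lra.
Qed.

Lemma exp_le (x z : R) : x <= z -> exp x <= exp z.
Proof. intros [H| ->]; [left; now apply exp_increasing|lra]. Qed.

Lemma exp_ge_1 (x : R) : 0 <= x -> 1 <= exp x.
Proof. intros H. rewrite <- exp_0. now apply exp_le. Qed.

Section Picard.
Context (f : R -> R -> R) (a : R).
Context (Cf : forall y, continuity (fun t => y (Rmax 0 t)) ->
  continuity (fun t => f (Rmax 0 t) (y (Rmax 0 t)))).
Context (Lf : forall T, 0 <= T -> exists L, 0 <= L /\ forall t x z, 0 <= t <= T ->
  Rabs (f t x - f t z) <= L * Rabs (x - z)).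

(** Time is clamped at 0 so that the integrand is continuous on all of R and its primitive has a
    two-sided derivative at 0. *)
Definition picard_slope (y : R -> R) (t : R) : R :=
  a + primitive (fun r => f (Rmax 0 r) (y (Rmax 0 r))) t.

Definition picard_step (y : R -> R) : R -> R := primitive (picard_slope y).

Fixpoint picard_iter (n : nat) : R -> R :=
  match n with O => fun _ => 0 | S n => picard_step (picard_iter n) end.

(** Convergence is established for t >= 0 only; the integral operator reads this function through
    [Rmax 0]. *)
Definition picard_limit (t : R) : R := real (Lim_seq (fun n => picard_iter n t)).

Lemma picard_slope_derive (y : R -> R) (s : R) :
  continuity (fun t => y (Rmax 0 t)) ->
  is_derive (picard_slope y) s (f (Rmax 0 s) (y (Rmax 0 s))).
Proof.
  intros C. rewrite <- (Rplus_0_l (f _ _)).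
  apply (is_derive_plus (fun _ => a)); [apply (is_derive_const a)|].
  apply (primitive_derive (fun r => f (Rmax 0 r) (y (Rmax 0 r)))). now apply Cf.
Qed.

Lemma picard_step_derive (y : R -> R) (s : R) :
  continuity (fun t => y (Rmax 0 t)) -> is_derive (picard_step y) s (picard_slope y s).
Proof.
  intros C. apply primitive_derive. intros x.
  now apply derive_continuity_pt with (1 := picard_slope_derive y x C).
Qed.

Lemma continuity_clamp_comp (y : R -> R) : continuity y -> continuity (fun t => y (Rmax 0 t)).
Proof.
  intros C. apply (continuity_comp (fun t => Rmax 0 t) y); [|assumption].
  apply (continuity_clamp (fun s => s)). intros s _. apply derive_continue_in with 1, (is_derive_id s).
Qed.

Lemma picard_iter_continuity (n : nat) : continuity (picard_iter n).
Proof.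
  induction n as [|n IH]; simpl.
  - apply continuity_const. now intros ? ?.
  - intros x. apply derive_continuity_pt with (picard_slope (picard_iter n) x), picard_step_derive.
    now apply continuity_clamp_comp.
Qed.

(* The weight exp ((1 + 2 L) t) makes the Picard map a 1/2-contraction on [0,T]. *)
Lemma picard_contraction (y z : R -> R) (L B T : R) :
  continuity (fun t => y (Rmax 0 t)) -> continuity (fun t => z (Rmax 0 t)) ->
  0 <= L -> 0 <= B ->
  (forall t x x', 0 <= t <= T -> Rabs (f t x - f t x') <= L * Rabs (x - x')) ->
  (forall t, 0 <= t <= T -> Rabs (y t - z t) <= B * exp ((1 + 2 * L) * t)) ->
  forall t, 0 <= t <= T -> Rabs (picard_step y t - picard_step z t) <= B / 2 * exp ((1 + 2 * L) * t).
Proof.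
  intros Cy Cz HL HB Lip Close.
  (* With k = 1 + 2 L, k B / 2 dominates both L B, needed for the slope, and B / 2, needed for the
     position. *)
  assert (S : forall t, 0 <= t <= T ->
    Rabs (picard_slope y t - picard_slope z t) <= B / 2 * exp ((1 + 2 * L) * t)).
  { intros t Ht.
    apply (exp_growth_bound (fun t => picard_slope y t - picard_slope z t)
      (fun t => f (Rmax 0 t) (y (Rmax 0 t)) - f (Rmax 0 t) (z (Rmax 0 t)))); try lra.
    - intros s Hs. apply (is_derive_minus (picard_slope y)); now apply picard_slope_derive.
    - intros s Hs. rewrite Rmax_right by lra.
      apply Rle_trans with (1 := Lip s (y s) (z s) ltac:(lra)).
      specialize (Close s ltac:(lra)). pose proof (exp_pos ((1 + 2 * L) * s)).
      assert (L * Rabs (y s - z s) <= L * (B * exp ((1 + 2 * L) * s))) by (apply Rmult_le_compat_l; assumption).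
      assert (0 <= B * exp ((1 + 2 * L) * s)) by nra. lra.
    - unfold picard_slope. rewrite !primitive_0. ring. }
  intros t Ht.
  apply (exp_growth_bound (fun t => picard_step y t - picard_step z t)
    (fun t => picard_slope y t - picard_slope z t)); try lra.
  - intros s Hs. apply (is_derive_minus (picard_step y)); now apply picard_step_derive.
  - intros s Hs. apply Rle_trans with (1 := S s ltac:(lra)).
    pose proof (exp_pos ((1 + 2 * L) * s)).
    assert (0 <= B / 2 * exp ((1 + 2 * L) * s)) by nra. nra.
  - unfold picard_step. rewrite !primitive_0. ring.
Qed.

Lemma picard_cauchy (T : R) : 0 <= T ->
  exists B, 0 <= B /\ forall n p t, 0 <= t <= T ->
    Rabs (picard_iter (n + p) t - picard_iter n t) <= B * (1 / 2) ^ n.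
Proof.
  intros HT. destruct (Lf T HT) as [L [HL Lip]].
  destruct (continuity_ab_maj (fun t => Rabs (picard_iter 1 t)) 0 T HT) as [p0 [Max _]].
  { intros t _. apply (continuity_pt_comp (picard_iter 1) Rabs);
      [apply picard_iter_continuity|apply Rcontinuity_abs]. }
  set (C := Rabs (picard_iter 1 p0)) in *. set (k := 1 + 2 * L).
  assert (HC : 0 <= C) by apply Rabs_pos.
  assert (Hstep : forall n t, 0 <= t <= T ->
    Rabs (picard_iter (S n) t - picard_iter n t) <= C * (1 / 2) ^ n * exp (k * t)).
  { induction n as [|n IH]; intros t Ht.
    - simpl. rewrite Rminus_0_r, !Rmult_1_r. specialize (Max t Ht). simpl in Max.
      assert (1 <= exp (k * t)).
      { apply exp_ge_1. unfold k. nra. }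
      nra.
    - replace (C * (1 / 2) ^ S n) with (C * (1 / 2) ^ n / 2) by (simpl; field).
      apply (picard_contraction (picard_iter (S n)) (picard_iter n) L _ T); auto.
      + apply continuity_clamp_comp, picard_iter_continuity.
      + apply continuity_clamp_comp, picard_iter_continuity.
      + apply Rmult_le_pos; [assumption|]. apply pow_le. lra. }
  exists (2 * C * exp (k * T)). split.
  { pose proof (exp_pos (k * T)). nra. }
  intros n p t Ht.
  assert (E : exp (k * t) <= exp (k * T)).
  { apply exp_le. unfold k. nra. }
  (* The factor 1 - (1/2)^p is the partial geometric sum, which makes the induction on p close. *)
  assert (Hp : Rabs (picard_iter (n + p) t - picard_iter n t) <=
    2 * C * exp (k * t) * ((1 / 2) ^ n * (1 - (1 / 2) ^ p))).
  { induction p as [|p IH].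
    - rewrite Nat.add_0_r, Rminus_diag, Rabs_R0. simpl. lra.
    - rewrite Nat.add_succ_r.
      replace (picard_iter (S (n + p)) t - picard_iter n t) with
        ((picard_iter (S (n + p)) t - picard_iter (n + p) t) + (picard_iter (n + p) t - picard_iter n t)) by ring.
      apply Rle_trans with (1 := Rabs_triang _ _).
      specialize (Hstep (n + p)%nat t Ht). rewrite pow_add in Hstep.
      replace ((1 / 2) ^ S p) with ((1 / 2) ^ p / 2) by (simpl; field). lra. }
  apply Rle_trans with (1 := Hp).
  assert (0 < (1 / 2) ^ n) by (apply pow_lt; lra).
  assert (0 < (1 / 2) ^ p) by (apply pow_lt; lra).
  pose proof (exp_pos (k * t)).
  apply Rle_trans with (2 * C * exp (k * t) * (1 / 2) ^ n).
  - apply Rmult_le_compat_l; [nra|]. nra.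
  - apply Rmult_le_compat_r; [lra|]. apply Rmult_le_compat_l; lra.
Qed.

Lemma half_pow_small (B eps : R) : 0 <= B -> 0 < eps -> exists N, forall n, (N <= n)%nat -> B * (1 / 2) ^ n < eps.
Proof.
  intros HB He.
  destruct (pow_lt_1_zero (1 / 2) ltac:(rewrite Rabs_pos_eq; lra) (eps / (B + 1))) as [N HN].
  { apply Rdiv_lt_0_compat; lra. }
  exists N. intros n Hn. specialize (HN n Hn).
  assert (0 < (1 / 2) ^ n) by (apply pow_lt; lra).
  rewrite Rabs_pos_eq in HN by lra.
  apply Rmult_lt_compat_r with (r := B + 1) in HN; [|lra].
  replace (eps / (B + 1) * (B + 1)) with eps in HN by (field; lra). nra.
Qed.

Lemma picard_limit_close (T : R) : 0 <= T ->
  exists B, 0 <= B /\ forall n t, 0 <= t <= T ->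
    Rabs (picard_iter n t - picard_limit t) <= B * (1 / 2) ^ n.
Proof.
  intros HT. destruct (picard_cauchy T HT) as [B [HB Cau]].
  exists B. split; [assumption|]. intros n t Ht.
  assert (Lim : is_lim_seq (fun n => picard_iter n t) (picard_limit t)).
  { apply Lim_seq_correct', ex_lim_seq_cauchy_corr. intros eps.
    destruct (half_pow_small B (eps / 2) HB) as [N HN]; [pose proof (cond_pos eps); lra|].
    exists N. intros i j Hi Hj.
    pose proof (Cau N (i - N)%nat t Ht) as C1. pose proof (Cau N (j - N)%nat t Ht) as C2.
    replace (N + (i - N))%nat with i in C1 by lia. replace (N + (j - N))%nat with j in C2 by lia.
    specialize (HN N ltac:(lia)).
    apply Rabs_le_between in C1. apply Rabs_le_between in C2. apply Rabs_def1; lra. }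
  apply le_epsilon. intros eps He. apply is_lim_seq_spec in Lim.
  destruct (Lim (mkposreal eps He)) as [N HN]. simpl in HN.
  specialize (HN (n + N)%nat ltac:(lia)). specialize (Cau n N t Ht).
  replace (picard_iter n t - picard_limit t) with
    ((picard_iter (n + N) t - picard_limit t) - (picard_iter (n + N) t - picard_iter n t)) by ring.
  apply Rle_trans with (1 := Rabs_triang _ _). rewrite Rabs_Ropp. lra.
Qed.

Lemma picard_limit_continuity : continuity (fun t => picard_limit (Rmax 0 t)).
Proof.
  intros t0 eps He.
  set (T := Rabs t0 + 1). assert (HT : 0 <= T) by (unfold T; pose proof (Rabs_pos t0); lra).
  destruct (picard_limit_close T HT) as [B [HB Close]].
  destruct (half_pow_small B (eps / 3) HB ltac:(lra)) as [n Hn]. specialize (Hn n ltac:(lia)).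
  destruct (continuity_pt_eps (fun t => picard_iter n (Rmax 0 t)) t0
    (continuity_clamp_comp _ (picard_iter_continuity n) t0) (eps / 3) ltac:(lra)) as [d [Hd P]].
  exists (Rmin d 1). split; [apply Rmin_pos; lra|]. intros x [_ Hx]. simpl in *. unfold Rdist in *.
  pose proof (Rmin_l d 1). pose proof (Rmin_r d 1). specialize (P x ltac:(lra)).
  assert (In : forall r, Rabs (r - t0) < 1 -> 0 <= Rmax 0 r <= T).
  { intros r Hr. split; [apply Rmax_l|]. apply Rmax_lub; [assumption|].
    apply Rabs_def2 in Hr. pose proof (Rle_abs t0). unfold T. lra. }
  pose proof (Close n _ (In x ltac:(lra))) as C1.
  pose proof (Close n _ (In t0 ltac:(rewrite Rminus_diag, Rabs_R0; lra))) as C2.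
  apply Rabs_le_between in C1. apply Rabs_le_between in C2. apply Rabs_def2 in P.
  apply Rabs_def1; lra.
Qed.

Lemma picard_limit_fixed (s : R) : 0 <= s -> picard_step picard_limit s = picard_limit s.
Proof.
  intros Hs. apply cond_eq. intros eps He.
  destruct (picard_limit_close s Hs) as [B [HB Close]].
  destruct (Lf s Hs) as [L [HL Lip]].
  pose proof (exp_pos ((1 + 2 * L) * s)) as Epos.
  destruct (half_pow_small (B + B * exp ((1 + 2 * L) * s)) eps ltac:(nra) He) as [n Hn].
  specialize (Hn n ltac:(lia)).
  assert (0 < (1 / 2) ^ n) by (apply pow_lt; lra).
  pose proof (picard_contraction picard_limit (picard_iter n) L (B * (1 / 2) ^ n) s) as C.
  specialize (C picard_limit_continuity (continuity_clamp_comp _ (picard_iter_continuity n)) HL ltac:(nra) Lip).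
  assert (C1 : Rabs (picard_step picard_limit s - picard_step (picard_iter n) s) <=
    B * (1 / 2) ^ n / 2 * exp ((1 + 2 * L) * s)).
  { apply C; [|lra]. intros t Ht. rewrite Rabs_minus_sym.
    apply Rle_trans with (1 := Close n t Ht).
    assert (1 <= exp ((1 + 2 * L) * t)).
    { apply exp_ge_1. nra. }
    assert (0 <= B * (1 / 2) ^ n) by nra. nra. }
  specialize (Close (S n) s ltac:(lra)).
  change (picard_step (picard_iter n) s) with (picard_iter (S n) s) in C1.
  replace (picard_step picard_limit s - picard_limit s) with
    ((picard_step picard_limit s - picard_iter (S n) s) + (picard_iter (S n) s - picard_limit s)) by ring.
  apply Rle_lt_trans with (1 := Rabs_triang _ _).
  replace ((1 / 2) ^ S n) with ((1 / 2) ^ n / 2) in Close by (simpl; field).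
  assert (0 <= B * (1 / 2) ^ n) by nra.
  assert (0 <= B * (1 / 2) ^ n * exp ((1 + 2 * L) * s)) by nra. lra.
Qed.

Lemma picard_lindelof :
  exists y v, y 0 = 0 /\ v 0 = a /\
    forall s, 0 <= s -> is_derive y s (v s) /\ is_derive v s (f s (y s)).
Proof.
  exists (picard_step picard_limit), (picard_slope picard_limit). split; [|split].
  - apply primitive_0.
  - unfold picard_slope. rewrite primitive_0. ring.
  - intros s Hs. split; [apply picard_step_derive, picard_limit_continuity|].
    rewrite picard_limit_fixed by assumption.
    replace (f s (picard_limit s)) with (f (Rmax 0 s) (picard_limit (Rmax 0 s))).
    + apply picard_slope_derive, picard_limit_continuity.
    + now rewrite Rmax_right.
Qed.

End Picard.

Lemma continuity_Rmax (g h : R -> R) :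
  continuity g -> continuity h -> continuity (fun t => Rmax (g t) (h t)).
Proof.
  intros Cg Ch x.
  assert (E : forall t, (g t + h t + Rabs (g t - h t)) * / 2 = Rmax (g t) (h t)).
  { intros t. unfold Rmax, Rabs. destruct (Rle_dec (g t) (h t)), (Rcase_abs (g t - h t)); lra. }
  assert (C : continuity_pt (fun t => (g t + h t + Rabs (g t - h t)) * / 2) x).
  { apply (continuity_pt_mult (fun t => g t + h t + Rabs (g t - h t)) (fun _ => / 2)).
    - apply (continuity_pt_plus (fun t => g t + h t)).
      + now apply (continuity_pt_plus g h).
      + apply (continuity_pt_comp (fun t => g t - h t) Rabs); [now apply (continuity_pt_minus g h)|].
        apply Rcontinuity_abs.
    - apply continuity_pt_const. now intros ? ?. }
  apply continuity_pt_ext with (2 := C). exact E.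
Qed.

Lemma continuity_Rmin (g h : R -> R) :
  continuity g -> continuity h -> continuity (fun t => Rmin (g t) (h t)).
Proof.
  intros Cg Ch x.
  apply continuity_pt_ext with (fun t => - Rmax (- g t) (- h t)).
  - intros t. rewrite Ropp_Rmax, !Ropp_involutive. reflexivity.
  - apply continuity_pt_opp. apply (continuity_Rmax (fun t => - g t) (fun t => - h t));
      now apply continuity_opp.
Qed.

(** * The clipped problem *)


(* Above sqrt the clipped equation is y'' = 0, so that y - sqrt s is convex there and a solution
   that crosses sqrt stays above it; the lower clip is never reached when 3 y'(0)^2 < r^3. *)
Definition clip (r s x : R) : R := Rmax (- (2 * sqrt s + r)) (Rmin x (sqrt s)).

Definition clipped_rhs (r s x : R) : R := (clip r s x ^ 2 - s) / 2.

Lemma clip_lipschitz (r s x z : R) : Rabs (clip r s x - clip r s z) <= Rabs (x - z).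
Proof.
  unfold clip, Rmax, Rmin.
  repeat destruct Rle_dec; unfold Rabs; repeat destruct Rcase_abs; lra.
Qed.

Lemma clip_bound (r s x : R) : 0 <= r -> Rabs (clip r s x) <= 2 * sqrt s + r.
Proof.
  intros Hr. pose proof (sqrt_pos s). unfold clip, Rmax, Rmin.
  repeat destruct Rle_dec; apply Rabs_le; lra.
Qed.

Lemma clipped_rhs_lipschitz (r T : R) : 0 <= r -> 0 <= T ->
  exists L, 0 <= L /\ forall t x z, 0 <= t <= T ->
    Rabs (clipped_rhs r t x - clipped_rhs r t z) <= L * Rabs (x - z).
Proof.
  intros Hr HT. exists (2 * sqrt T + r). pose proof (sqrt_pos T). split; [lra|].
  intros t x z Ht. assert (sqrt t <= sqrt T) by (apply sqrt_le_1_alt; lra).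
  pose proof (clip_bound r t x Hr) as B1. pose proof (clip_bound r t z Hr) as B2.
  unfold clipped_rhs.
  replace ((clip r t x ^ 2 - t) / 2 - (clip r t z ^ 2 - t) / 2) with
    ((clip r t x + clip r t z) / 2 * (clip r t x - clip r t z)) by field.
  rewrite Rabs_mult. apply Rmult_le_compat; try apply Rabs_pos; [|apply clip_lipschitz].
  apply Rabs_le. apply Rabs_le_between in B1. apply Rabs_le_between in B2. lra.
Qed.

Lemma clipped_rhs_continuity (r : R) (y : R -> R) :
  continuity (fun t => y (Rmax 0 t)) ->
  continuity (fun t => clipped_rhs r (Rmax 0 t) (y (Rmax 0 t))).
Proof.
  intros Cy.
  assert (Cm : continuity (fun t => Rmax 0 t)).
  { apply (continuity_Rmax (fun _ => 0) (fun t => t)); [|apply derivable_continuous, derivable_id].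
    apply continuity_const. now intros ? ?. }
  assert (Cs : continuity (fun t => sqrt (Rmax 0 t))).
  { intros t. apply (continuity_pt_comp (fun t => Rmax 0 t) sqrt); [apply Cm|].
    apply continuity_pt_sqrt, Rmax_l. }
  assert (Cc : continuity (fun t => clip r (Rmax 0 t) (y (Rmax 0 t)))).
  { unfold clip. apply (continuity_Rmax (fun t => - (2 * sqrt (Rmax 0 t) + r))
      (fun t => Rmin (y (Rmax 0 t)) (sqrt (Rmax 0 t)))).
    - apply (continuity_opp (fun t => 2 * sqrt (Rmax 0 t) + r)).
      apply (continuity_plus (fun t => 2 * sqrt (Rmax 0 t)) (fun _ => r)).
      + now apply (continuity_scal (fun t => sqrt (Rmax 0 t))).
      + apply continuity_const. now intros ? ?.
    - now apply continuity_Rmin. }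
  assert (C : continuity (fun t => (clip r (Rmax 0 t) (y (Rmax 0 t)) ^ 2 - Rmax 0 t) * / 2)); [|exact C].
  apply (continuity_mult (fun t => clip r (Rmax 0 t) (y (Rmax 0 t)) ^ 2 - Rmax 0 t) (fun _ => / 2)).
  - apply (continuity_minus (fun t => clip r (Rmax 0 t) (y (Rmax 0 t)) ^ 2)); [|assumption].
    apply (continuity_comp (fun t => clip r (Rmax 0 t) (y (Rmax 0 t))) (fun z => z ^ 2)); [assumption|].
    intros x. apply derivable_continuous_pt, derivable_pt_pow.
  - apply continuity_const. now intros ? ?.
Qed.

Definition clipped_solution (r a : R) (y v : R -> R) : Prop :=
  y 0 = 0 /\ v 0 = a /\
  forall s, 0 <= s -> is_derive y s (v s) /\ is_derive v s (clipped_rhs r s (y s)).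

Lemma clipped_solution_exists (r a : R) : 0 <= r -> exists y v, clipped_solution r a y v.
Proof.
  intros Hr. apply (picard_lindelof (clipped_rhs r) a).
  - intros y. apply clipped_rhs_continuity.
  - intros T HT. now apply clipped_rhs_lipschitz.
Qed.

(** E depends on r and T only. The case a = b is uniqueness for the clipped problem. *)
Lemma clipped_solution_dependence (r T : R) : 0 <= r -> 0 <= T ->
  exists E, 0 < E /\ forall a b y v z w,
    clipped_solution r a y v -> clipped_solution r b z w ->
    Rabs (z T - y T) <= E * Rabs (b - a) /\ Rabs (w T - v T) <= E * Rabs (b - a).
Proof.
  intros Hr HT. destruct (clipped_rhs_lipschitz r T Hr HT) as [L [HL Lip]].
  set (E := exp ((1 + L) * T)). assert (HE : 1 <= E) by (apply exp_ge_1; nra).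
  exists E. split; [lra|]. intros a b y v z w [y0 [v0 D]] [z0 [w0 D']].
  assert (B : (z T - y T) ^ 2 + (w T - v T) ^ 2 <= ((z 0 - y 0) ^ 2 + (w 0 - v 0) ^ 2) * E).
  { apply (energy_bound (fun s => z s - y s) (fun s => w s - v s)
      (fun s => clipped_rhs r s (z s) - clipped_rhs r s (y s))); try assumption.
    - intros s Hs. apply (is_derive_minus z); [apply D'|apply D]; lra.
    - intros s Hs. apply (is_derive_minus w); [apply D'|apply D]; lra.
    - intros s Hs. apply Lip. assumption. }
  rewrite y0, v0, z0, w0 in B.
  (* As E >= 1, E may replace its square root. *)
  assert (Sq : forall x, x ^ 2 <= (b - a) ^ 2 * E -> Rabs x <= E * Rabs (b - a)).
  { intros x Hx. apply Rsqr_incr_0_var; [|apply Rmult_le_pos; [lra|apply Rabs_pos]].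
    unfold Rsqr. rewrite <- (pow2_abs x), <- (pow2_abs (b - a)) in Hx.
    assert (0 <= Rabs (b - a) ^ 2 * E * (E - 1)).
    { apply Rmult_le_pos; [|lra]. apply Rmult_le_pos; [apply pow2_ge_0|lra]. }
    nra. }
  pose proof (pow2_ge_0 (z T - y T)). pose proof (pow2_ge_0 (w T - v T)).
  split; apply Sq; nra.
Qed.

Section Clipped.
Context (r a : R) (y v : R -> R) (Hs : clipped_solution r a y v).
Context (Hr : 0 < r) (Har : 3 * a ^ 2 < r ^ 3).

Lemma clipped_rhs_above (s : R) : 0 <= s -> sqrt s <= y s -> clipped_rhs r s (y s) = 0.
Proof.
  intros Hs0 W. pose proof (sqrt_pos s). unfold clipped_rhs, clip.
  rewrite Rmin_right, Rmax_right by lra. replace (sqrt s ^ 2) with s; [field|].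
  rewrite <- (sqrt_sqrt s) at 1 by assumption. ring.
Qed.

Lemma clipped_lt_sqrt (s t : R) : 0 < s < t -> y t <= sqrt t -> y s < sqrt s.
Proof.
  intros H W. enough (y s - sqrt s < 0) by lra.
  destruct Hs as [y0 [_ D]].
  apply (below_sqrt y v (fun s => clipped_rhs r s (y s)) s t 0); try lra.
  - intros x Hx. apply D; lra.
  - intros x Hx. apply D; lra.
  - intros x Hx Wx. rewrite clipped_rhs_above; lra.
Qed.

Lemma clipped_flow_below (s : R) :
  0 <= s -> - (2 * sqrt s + r) <= y s -> y s <= sqrt s -> flow y v s.
Proof.
  intros Hs0 B W. destruct Hs as [_ [_ D]]. destruct (D s Hs0) as [D1 D2].
  split; [assumption|]. unfold clipped_rhs, clip in D2.
  rewrite Rmin_left, Rmax_right in D2 by assumption. exact D2.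
Qed.

(* Below the lower clip the defect would exceed r^3/3 > v(0)^2, although it is nonincreasing. *)
Lemma clipped_flow (b : R) : 0 < b -> y b <= sqrt b -> forall s, 0 <= s <= b -> flow y v s.
Proof.
  intros Hb Wb.
  assert (W : forall s, 0 <= s <= b -> y s <= sqrt s).
  { intros s Hs'. destruct (Req_dec s 0) as [->|].
    - rewrite sqrt_0. destruct Hs; lra.
    - destruct (Req_dec s b) as [->|]; [assumption|]. left. apply clipped_lt_sqrt with b; [lra|assumption]. }
  assert (B : forall s, 0 <= s <= b -> 0 < y s + 2 * sqrt s + r).
  { intros s Hsb. apply Rnot_le_lt. intros L. destruct Hs as [y0 [v0 D]].
    destruct (first_zero (fun s => y s + 2 * sqrt s + r) 0 s) as [c [Hc [Z P]]].
    - destruct (Req_dec s 0) as [->|]; [rewrite y0, sqrt_0 in L; lra|lra].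
    - intros t Ht. apply (continuity_pt_plus (fun t => y t + 2 * sqrt t) (fun _ => r)).
      + apply (continuity_pt_plus y (fun t => 2 * sqrt t)).
        * apply derive_continuity_pt with (v t), D; lra.
        * apply (continuity_pt_scal sqrt). apply continuity_pt_sqrt; lra.
      + apply continuity_pt_const. now intros ? ?.
    - rewrite y0, sqrt_0. lra.
    - assumption.
    - simpl in *. assert (defect y v c <= defect y v 0).
      { apply defect_le; [lra| |].
        - intros t Ht. apply clipped_flow_below; [lra| |apply W; lra].
          destruct (Req_dec t c) as [->|]; [lra|]. specialize (P t ltac:(lra)). lra.
        - intros t Ht. apply W; lra. }
      unfold defect in H. rewrite y0, v0, sqrt_0 in H.
      pose proof (pow2_ge_0 (v c)). pose proof (sqrt_pos c).
      replace (y c) with (- (2 * sqrt c) - r) in H by lra.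
      assert (r ^ 2 <= (3 * sqrt c + r) ^ 2) by (apply pow_incr; lra).
      assert (r * r ^ 2 <= r * (3 * sqrt c + r) ^ 2) by (apply Rmult_le_compat_l; lra).
      replace ((sqrt c - (- (2 * sqrt c) - r)) ^ 2 * (- (2 * sqrt c) - r + 2 * sqrt c) / 3)
        with (- (r * (3 * sqrt c + r) ^ 2) / 3) in H by field.
      simpl in *. lra. }
  intros s Hsb. apply clipped_flow_below; [lra| |now apply W]. specialize (B s Hsb). lra.
Qed.

(** At a crossing F = v^2 >= 0, but F cannot increase while y <= sqrt. A crossing before s is
    excluded because a solution above sqrt stays there. *)
Lemma crossing_excludes_negative_defect (s t : R) :
  0 < s -> y s < sqrt s -> defect y v s < 0 -> 0 < t -> y t <= sqrt t.
Proof.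
  intros Hs0 Ws Ds Ht. apply Rnot_lt_le. intros Wt.
  destruct (Rtotal_order t s) as [L|[->|G]]; [|lra|].
  - assert (y t < sqrt t) by (apply clipped_lt_sqrt with s; lra). lra.
  - destruct (first_zero (fun x => sqrt x - y x) s t G) as [c [Hc [Z P]]].
    + intros x Hx. apply (continuity_pt_minus sqrt y); [apply continuity_pt_sqrt; lra|].
      destruct Hs as [_ [_ D]]. apply derive_continuity_pt with (v x), D; lra.
    + lra.
    + lra.
    + assert (F : forall x, 0 <= x <= c -> flow y v x) by (apply clipped_flow; lra).
      assert (defect y v c <= defect y v s).
      { apply defect_le; [lra|intros; apply F; lra|]. intros x Hx. specialize (P x ltac:(lra)). lra. }
      unfold defect at 1 in H. replace (sqrt c - y c) with 0 in H by lra.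
      pose proof (pow2_ge_0 (v c)). lra.
Qed.

End Clipped.

(** Connectedness of [a, b]: c is the end of the longest initial segment contained in P, and
    openness keeps it out of both sets. *)
Lemma continuous_dichotomy_gap (P Q : R -> Prop) (a b : R) :
  a < b ->
  (forall x, a <= x <= b -> P x -> exists d, 0 < d /\ forall t, a <= t <= b -> Rabs (t - x) < d -> P t) ->
  (forall x, a <= x <= b -> Q x -> exists d, 0 < d /\ forall t, a <= t <= b -> Rabs (t - x) < d -> Q t) ->
  (forall x, a <= x <= b -> P x -> Q x -> False) -> P a -> Q b ->
  exists c, a < c < b /\ ~ P c /\ ~ Q c.
Proof.
  intros ab OP OQ Dis Pa Qb.
  set (E := fun x => a <= x <= b /\ forall t, a <= t <= x -> P t).
  destruct (completeness E) as [c [ub lub]].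
  - exists b. intros x [Hx _]; lra.
  - exists a. split; [lra|]. intros t Ht. now replace t with a by lra.
  - assert (ac : a <= c) by (apply ub; split; [lra|]; intros t Ht; now replace t with a by lra).
    assert (cb : c <= b) by (apply lub; intros x [Hx _]; lra).
    assert (below : forall t, a <= t < c -> P t).
    { intros t Ht. apply Classical_Prop.NNPP. intros N.
      assert (c <= t); [|lra]. apply lub. intros x [Hx Px]. apply Rnot_lt_le. intros L.
      apply N, Px. lra. }
    assert (nP : ~ P c).
    { intros Pc. assert (c < b) by (destruct (Req_dec c b) as [->|]; [exfalso; apply (Dis b); auto; lra|lra]).
      destruct (OP c ltac:(lra) Pc) as [d [Hd H']].
      set (t := Rmin b (c + d / 2)).
      assert (c < t <= b /\ t < c + d) as [Ht Hdt].
      { unfold t, Rmin. destruct (Rle_dec b (c + d / 2)); lra. }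
      assert (t <= c); [|lra]. apply ub. split; [lra|]. intros s Hs.
      destruct (Rlt_le_dec s c); [apply below; lra|]. apply H'; [lra|]. apply Rabs_def1; lra. }
    assert (a < c) by (destruct (Req_dec a c) as [<-|]; [contradiction|lra]).
    assert (nQ : ~ Q c).
    { intros Qc. destruct (OQ c ltac:(lra) Qc) as [d [Hd H']].
      set (t := Rmax a (c - d / 2)).
      assert (a <= t < c /\ c - d < t) as [Ht Hdt].
      { unfold t, Rmax. destruct (Rle_dec a (c - d / 2)); lra. }
      apply (Dis t); [lra|apply below; lra|]. apply H'; [lra|]. apply Rabs_def1; lra. }
    exists c. split; [|now split].
    split; [assumption|]. destruct (Req_dec c b) as [->|]; [contradiction|lra].
Qed.

(** Otherwise F' = y - sqrt s <= -1, and F is negative after time F(a) + 1. *)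
Lemma nonneg_defect_gap (y v : R -> R) (a : R) :
  1 <= a -> (forall s, a <= s -> flow y v s) -> (forall s, a <= s -> 0 <= defect y v s) ->
  ~ (forall s, a <= s -> y s <= sqrt s - 1).
Proof.
  intros Ha Fl D W.
  destruct (mvt (defect y v) (fun s => y s - sqrt s) a (a + defect y v a + 1)) as [c [Hc E]].
  - specialize (D a ltac:(lra)). lra.
  - intros s Hs. apply defect_derive; [lra|apply Fl; lra].
  - specialize (W c ltac:(lra)). pose proof (D a ltac:(lra)).
    specialize (D (a + defect y v a + 1) ltac:(lra)). nra.
Qed.

(** [nonneg_defect_gap] forces first a positive slope, which persists, and then a positive value.
    From there on y is concave, so v stays bounded, and F >= 0 bounds (sqrt s - y)^2 sqrt s by 3
    v^2. *)
Lemma nonneg_defect_connection (y v : R -> R) :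
  ivp_solution y v -> (forall s, 0 < s -> y s < sqrt s) -> (forall s, 0 < s -> 0 <= defect y v s) ->
  connection y v.
Proof.
  intros Hs W D. pose proof (proj2 Hs) as Fl.
  assert (Ex0 : exists s0, 1 <= s0 /\ 0 < v s0).
  { apply Classical_Prop.NNPP. intros No.
    (* From s = 4 on sqrt s >= 2, while a nowhere positive slope keeps y s <= y 1 < 1. *)
    apply (nonneg_defect_gap y v 4); [lra|intros; apply Fl; lra|intros; apply D; lra|].
    intros s Hs4.
    assert (2 <= sqrt s).
    { replace 2 with (sqrt 4) by (replace 4 with (2 ^ 2) by ring; apply sqrt_pow2; lra).
      apply sqrt_le_1_alt; lra. }
    assert (y s <= y 1).
    { apply (derive_nonpos_le y v); [lra|intros; apply Fl; lra|]. intros t Ht.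
      apply Rnot_lt_le. intros L. apply No. exists t. lra. }
    specialize (W 1 ltac:(lra)). rewrite sqrt_1 in W. lra. }
  destruct Ex0 as [s0 [Hs0 V0]].
  assert (Vpos : forall s, s0 <= s -> 0 < v s).
  { intros s Hss. apply (slope_stays_pos y v s0 s); [lra|assumption|intros; apply Fl; lra|].
    intros t Ht. split; [apply D; lra|apply W; lra]. }
  assert (Ex1 : exists s1, s0 <= s1 /\ 0 < y s1).
  { apply Classical_Prop.NNPP. intros No.
    apply (nonneg_defect_gap y v s0); [lra|intros; apply Fl; lra|intros; apply D; lra|].
    intros s Hss. assert (1 <= sqrt s) by (rewrite <- sqrt_1; apply sqrt_le_1_alt; lra).
    assert (y s <= 0); [|lra]. apply Rnot_lt_le. intros L. apply No. exists s. lra. }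
  destruct Ex1 as [s1 [Hs1 Y1]].
  assert (Ypos : forall s, s1 <= s -> 0 < y s).
  { intros s Hss. apply Rlt_le_trans with (1 := Y1).
    apply (derive_nonneg_le y v); [lra|intros; apply Fl; lra|]. intros t Ht. left. apply Vpos; lra. }
  assert (Vle : forall s, s1 <= s -> v s <= v s1).
  { intros s Hss. apply (derive_nonpos_le v (fun s => (y s ^ 2 - s) / 2)); [lra|intros; apply Fl; lra|].
    intros t Ht. specialize (Ypos t ltac:(lra)). specialize (W t ltac:(lra)).
    pose proof (sqrt_sqrt t ltac:(lra)). nra. }
  split; [assumption|]. apply is_lim_spec. intros eps. pose proof (cond_pos eps) as He.
  (* A gap of at least eps at time s would give eps^2 sqrt s <= 3 (v s1)^2, that is sqrt s <= K. *)
  set (K := 3 * v s1 ^ 2 / eps ^ 2).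
  assert (HK : 0 < K).
  { unfold K. specialize (Vpos s1 Hs1). apply Rdiv_lt_0_compat; [|now apply pow_lt].
    pose proof (pow_lt _ 2 Vpos). lra. }
  exists (Rmax s1 (K ^ 2)). intros s Hss.
  pose proof (Rmax_l s1 (K ^ 2)). pose proof (Rmax_r s1 (K ^ 2)).
  specialize (W s ltac:(lra)). specialize (D s ltac:(lra)). specialize (Ypos s ltac:(lra)).
  specialize (Vle s ltac:(lra)). specialize (Vpos s ltac:(lra)).
  rewrite Rminus_0_r, Rabs_left by lra. apply Rnot_le_lt. intros L.
  assert (sK : K < sqrt s).
  { rewrite <- (sqrt_pow2 K) by lra. apply sqrt_lt_1_alt. pose proof (pow2_ge_0 K). lra. }
  unfold defect in D. set (x := sqrt s - y s) in *.
  assert (eps ^ 2 <= x ^ 2) by (apply pow_incr; unfold x; lra).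
  assert (v s ^ 2 <= v s1 ^ 2) by (apply pow_incr; lra).
  assert (E : eps ^ 2 * K = 3 * v s1 ^ 2) by (unfold K; field; lra).
  assert (0 < eps ^ 2) by now apply pow_lt.
  assert (eps ^ 2 * K < eps ^ 2 * sqrt s) by (apply Rmult_lt_compat_l; assumption).
  assert (eps ^ 2 * sqrt s <= x ^ 2 * (y s + 2 * sqrt s)) by (apply Rmult_le_compat; lra).
  lra.
Qed.

(* With b = - y - s^3/12, b'' = - y^2/2: a large b in the middle of [0,1] would push b 1 below
   -2.  Hence b, y and finally the initial slope are bounded. *)
Lemma crossing_of_steep_descent (y v : R -> R) :
  y 0 = 0 -> (forall s, 0 <= s <= 1 -> flow y v s) -> y 1 <= 1 -> - v 0 < 100000.
Proof.
  intros y0 Fl Y1. set (b := fun s => - y s - s ^ 3 / 12). set (p := fun s => - v s - s ^ 2 / 4).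
  assert (Db : forall s, 0 <= s <= 1 -> is_derive b s (p s)).
  { intros s Hs. destruct (Fl s Hs) as [D1 _]. unfold b, p.
    auto_derive; [repeat split; eexists; eassumption|].
    change (fun x => y x) with y. rewrite (is_derive_unique _ _ _ D1). field. }
  assert (Dp : forall s, 0 <= s <= 1 -> is_derive p s (- y s ^ 2 / 2)).
  { intros s Hs. destruct (Fl s Hs) as [_ D2]. unfold p.
    auto_derive; [repeat split; eexists; eassumption|].
    change (fun x => v x) with v. rewrite (is_derive_unique _ _ _ D2). field. }
  assert (pdec : forall s t, 0 <= s <= t -> t <= 1 -> p t <= p s).
  { intros s t Hst Ht. apply (derive_nonpos_le p (fun s => - y s ^ 2 / 2)); [lra|intros; apply Dp; lra|].
    intros x Hx. pose proof (pow2_ge_0 (y x)). lra. }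
  assert (chord : forall s t x, 0 <= s <= x -> x <= t <= 1 -> (t - x) * b s + (x - s) * b t <= (t - s) * b x).
  { intros s t x H H'. apply (concave_chord b p); [lra|intros; apply Db; lra|intros; apply pdec; lra]. }
  assert (b0 : b 0 = 0) by (unfold b; rewrite y0; field).
  assert (b1 : - 2 <= b 1) by (unfold b; lra).
  (* Let mu be the smaller of b(1/4) and b(3/4). Concavity gives b(1/4) <= 3 mu + 4, so b(1/4) > 300
     means mu > 98. The change of b' across [1/4, 3/4] gives mu^2 <= 96 mu + 160, false for such
     mu. *)
  assert (b14 : b (1 / 4) <= 300).
  { apply Rnot_lt_le. intros L.
    destruct (mvt b p 0 (1 / 4)) as [c1 [Hc1 E1]]; [lra|intros; apply Db; lra|].
    destruct (mvt b p (3 / 4) 1) as [c2 [Hc2 E2]]; [lra|intros; apply Db; lra|].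
    destruct (mvt p (fun s => - y s ^ 2 / 2) (1 / 4) (3 / 4)) as [c [Hc E]]; [lra|intros; apply Dp; lra|].
    pose proof (pdec c1 (1 / 4) ltac:(lra) ltac:(lra)).
    pose proof (pdec (3 / 4) c2 ltac:(lra) ltac:(lra)).
    pose proof (chord 0 (3 / 4) (1 / 4) ltac:(lra) ltac:(lra)) as K1.
    pose proof (chord (1 / 4) 1 (3 / 4) ltac:(lra) ltac:(lra)) as K2.
    pose proof (chord (1 / 4) (3 / 4) c ltac:(lra) ltac:(lra)) as K3.
    rewrite b0 in *.
    set (mu := Rmin (b (1 / 4)) (b (3 / 4))).
    assert (M : mu <= b (1 / 4) /\ mu <= b (3 / 4)) by (split; [apply Rmin_l|apply Rmin_r]).
    assert (M2 : b (1 / 4) <= 3 * mu + 4 /\ b (3 / 4) <= 3 * mu + 4).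
    { unfold mu, Rmin. destruct (Rle_dec (b (1 / 4)) (b (3 / 4))); lra. }
    assert (bc : mu <= b c) by nra.
    assert (y c <= - mu) by (unfold b in bc; assert (0 <= c ^ 3) by (apply pow_le; lra); lra).
    assert (mu ^ 2 <= y c ^ 2) by (assert (0 < mu) by lra; nra).
    assert (mu ^ 2 <= 96 * mu + 160) by lra. nra. }
  assert (blow : forall s, 0 <= s <= 1 -> - 2 <= b s).
  { intros s Hs. pose proof (chord 0 1 s ltac:(lra) ltac:(lra)). nra. }
  assert (bup : forall s, 0 <= s <= 1 / 4 -> b s <= 402).
  { intros s Hs. pose proof (chord s 1 (1 / 4) ltac:(lra) ltac:(lra)) as K.
    apply Rnot_lt_le. intros L. nra. }
  destruct (mvt b p 0 (1 / 4)) as [c1 [Hc1 E1]]; [lra|intros; apply Db; lra|].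
  destruct (mvt p (fun s => - y s ^ 2 / 2) 0 c1) as [c [Hc E]]; [lra|intros; apply Dp; lra|].
  pose proof (blow c ltac:(lra)) as B1. pose proof (bup c ltac:(lra)) as B2.
  assert (p0 : p 0 = - v 0) by (unfold p; field).
  assert (- 403 <= y c <= 403).
  { unfold b in B1, B2. assert (0 <= c ^ 3 <= 1).
    { split; [apply pow_le; lra|]. rewrite <- (pow1 3). apply pow_incr. lra. }
    lra. }
  assert (y c ^ 2 <= 403 ^ 2) by nra.
  (* Hence - v 0 = p 0 <= 4 * 300 + 403^2 / 2 < 100000. *)
  assert (- y c ^ 2 / 2 * (c1 - 0) >= - 403 ^ 2 / 2 * 1) by nra.
  rewrite b0 in E1. lra.
Qed.

(** * Shooting *)


(** By uniqueness for the clipped problem, the choice of y and v here and in [trapped] is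
    immaterial. *)
Definition crosses (r a : R) : Prop :=
  exists y v, clipped_solution r a y v /\ exists s, 0 < s /\ sqrt s < y s.

Definition trapped (r a : R) : Prop :=
  exists y v, clipped_solution r a y v /\
    exists s, 0 < s /\ y s < sqrt s /\ defect y v s < 0.

Lemma crosses_open (r a : R) : 0 <= r -> crosses r a ->
  exists d, 0 < d /\ forall b, Rabs (b - a) < d -> crosses r b.
Proof.
  intros Hr [y [v [Hy [s [Hs W]]]]].
  destruct (clipped_solution_dependence r s Hr ltac:(lra)) as [E [HE Dep]].
  exists ((y s - sqrt s) / E). split; [apply Rdiv_lt_0_compat; lra|].
  intros b Hb. destruct (clipped_solution_exists r b Hr) as [z [w Hz]].
  exists z, w. split; [assumption|]. exists s. split; [assumption|].
  destruct (Dep a b y v z w Hy Hz) as [C _].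
  apply Rmult_lt_compat_l with (r := E) in Hb; [|assumption].
  replace (E * ((y s - sqrt s) / E)) with (y s - sqrt s) in Hb by (field; lra).
  apply Rabs_le_between in C. lra.
Qed.

Lemma trapped_open (r a : R) : 0 <= r -> trapped r a ->
  exists d, 0 < d /\ forall b, Rabs (b - a) < d -> trapped r b.
Proof.
  intros Hr [y [v [Hy [s [Hs [W D]]]]]].
  destruct (clipped_solution_dependence r s Hr ltac:(lra)) as [E [HE Dep]].
  set (F := fun p q => q ^ 2 - (sqrt s - p) ^ 2 * (p + 2 * sqrt s) / 3).
  assert (CF : continuity_2d_pt F (y s) (v s)).
  { apply (continuity_2d_pt_ext (fun p q => q * q - ((sqrt s - p) * (sqrt s - p)) * (p + 2 * sqrt s) * / 3)).
    { intros. unfold F. field. }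
    repeat first [apply continuity_2d_pt_minus | apply continuity_2d_pt_mult
      | apply continuity_2d_pt_plus | apply continuity_2d_pt_id1
      | apply continuity_2d_pt_id2 | apply continuity_2d_pt_const]. }
  assert (Hneg : 0 < - defect y v s) by lra.
  destruct (CF (mkposreal _ Hneg)) as [d Hd]. simpl in Hd. pose proof (cond_pos d) as dpos.
  set (m := Rmin d (sqrt s - y s)). assert (Hm : 0 < m) by (apply Rmin_pos; lra).
  exists (m / E). split; [now apply Rdiv_lt_0_compat|].
  intros b Hb. destruct (clipped_solution_exists r b Hr) as [z [w Hz]].
  exists z, w. split; [assumption|]. exists s. split; [assumption|].
  destruct (Dep a b y v z w Hy Hz) as [C1 C2].
  apply Rmult_lt_compat_l with (r := E) in Hb; [|assumption].
  replace (E * (m / E)) with m in Hb by (field; lra).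
  assert (m <= d) by apply Rmin_l. assert (m <= sqrt s - y s) by apply Rmin_r.
  specialize (Hd (z s) (w s) ltac:(lra) ltac:(lra)).
  change (F (z s) (w s)) with (defect z w s) in Hd. change (F (y s) (v s)) with (defect y v s) in Hd.
  apply Rabs_le_between in C1. apply Rabs_def2 in Hd. split; lra.
Qed.

Lemma crosses_trapped_disjoint (r a : R) :
  0 < r -> 3 * a ^ 2 < r ^ 3 -> crosses r a -> trapped r a -> False.
Proof.
  intros Hr Har [y [v [Hy [s [Hs W]]]]] [z [w [Hz [t [Ht [Wt Dt]]]]]].
  destruct (clipped_solution_dependence r s ltac:(lra) ltac:(lra)) as [E [HE Dep]].
  destruct (Dep a a y v z w Hy Hz) as [C _].
  rewrite (Rminus_diag a), Rabs_R0 in C. apply Rabs_le_between in C.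
  pose proof (crossing_excludes_negative_defect r a z w Hz Hr Har t s Ht Wt Dt Hs). lra.
Qed.

Lemma neither_connection (r a : R) :
  0 < r -> 3 * a ^ 2 < r ^ 3 -> ~ crosses r a -> ~ trapped r a ->
  exists y v, connection y v /\ v 0 = a.
Proof.
  intros Hr Har NC NT. destruct (clipped_solution_exists r a ltac:(lra)) as [y [v Hy]].
  assert (W : forall s, 0 < s -> y s <= sqrt s).
  { intros s Hs. apply Rnot_lt_le. intros L. apply NC. exists y, v. split; [assumption|now exists s]. }
  assert (Wlt : forall s, 0 < s -> y s < sqrt s).
  { intros s Hs. apply (clipped_lt_sqrt r a y v Hy Hr s (s + 1)); [lra|apply W; lra]. }
  exists y, v. split; [|apply Hy]. apply nonneg_defect_connection; [split; [apply Hy|]|assumption|].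
  - intros s Hs. apply (clipped_flow r a y v Hy Hr Har (s + 1)); [lra|apply W; lra|lra].
  - intros s Hs. apply Rnot_lt_le. intros L. apply NT. exists y, v.
    split; [assumption|]. exists s. auto.
Qed.

(** F(0) = 0 for zero slope, and F decreases strictly while y < sqrt s. This holds near 0, where y
    has slope below 1 and s < sqrt s. *)
Lemma trapped_zero (r : R) : 0 < r -> trapped r 0.
Proof.
  intros Hr. destruct (clipped_solution_exists r 0 ltac:(lra)) as [y [v Hy]].
  exists y, v. split; [assumption|]. pose proof Hy as [y0 [v0 D]].
  destruct (continuity_pt_eps v 0) with (eps := 1) as [d [Hd P]].
  { apply derive_continuity_pt with (1 := proj2 (D 0 ltac:(lra))). }
  { lra. }
  set (s := Rmin (d / 2) (1 / 2)).
  assert (0 < s /\ s < d /\ s < 1) as [Hs [Hsd Hs1]].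
  { unfold s, Rmin. destruct (Rle_dec (d / 2) (1 / 2)); lra. }
  assert (Ws : y s < sqrt s).
  { destruct (mvt y v 0 s) as [c [Hc E]]; [lra|intros; apply D; lra|].
    specialize (P c). rewrite v0, Rminus_0_r, Rminus_0_r, Rabs_pos_eq in P by lra.
    specialize (P ltac:(lra)). apply Rabs_def2 in P.
    pose proof (sqrt_lt_R0 s Hs). pose proof (sqrt_sqrt s ltac:(lra)).
    assert (sqrt s < 1) by (rewrite <- sqrt_1; apply sqrt_lt_1_alt; lra).
    assert (s < sqrt s) by nra. rewrite y0 in E. nra. }
  exists s. split; [assumption|split; [assumption|]].
  assert (F : forall x, 0 <= x <= s -> flow y v x).
  { apply (clipped_flow r 0 y v Hy Hr); [pose proof (pow_lt r 3 Hr); lra|assumption|lra]. }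
  assert (defect y v s < defect y v 0).
  { apply defect_lt; [lra|assumption|]. intros x Hx.
    apply (clipped_lt_sqrt r 0 y v Hy Hr x s); lra. }
  unfold defect at 2 in H. rewrite y0, v0, sqrt_0 in H. lra.
Qed.

(** On [0, 1] the clipped right-hand side is at least -1/2, so y 1 >= a - 1/2 > 1. *)
Lemma crosses_steep_ascent (r a : R) : 0 < r -> 2 <= a -> crosses r a.
Proof.
  intros Hr Ha. destruct (clipped_solution_exists r a ltac:(lra)) as [y [v Hy]].
  exists y, v. split; [assumption|]. exists 1. split; [lra|]. rewrite sqrt_1.
  destruct Hy as [y0 [v0 D]].
  destruct (mvt y v 0 1) as [c [Hc E]]; [lra|intros; apply D; lra|].
  destruct (mvt v (fun s => clipped_rhs r s (y s)) 0 c) as [x [Hx E']]; [lra|intros; apply D; lra|].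
  assert (- 1 / 2 <= clipped_rhs r x (y x)).
  { unfold clipped_rhs. pose proof (pow2_ge_0 (clip r x (y x))). lra. }
  rewrite y0 in E. rewrite v0 in E'. nra.
Qed.

Lemma crosses_steep_descent (r a : R) :
  0 < r -> 3 * a ^ 2 < r ^ 3 -> a <= - 100000 -> crosses r a.
Proof.
  intros Hr Har Ha. apply Classical_Prop.NNPP. intros N.
  destruct (clipped_solution_exists r a ltac:(lra)) as [y [v Hy]].
  assert (W : y 1 <= 1).
  { apply Rnot_lt_le. intros L. apply N. exists y, v. split; [assumption|].
    exists 1. rewrite sqrt_1. lra. }
  pose proof (crossing_of_steep_descent y v (proj1 Hy)) as B.
  rewrite (proj1 (proj2 Hy)) in B.
  assert (- a < 100000); [|lra]. apply B; [|assumption].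
  apply (clipped_flow r a y v Hy Hr Har); [lra|]. now rewrite sqrt_1.
Qed.

Lemma connections_exist :
  (exists y v, connection y v /\ 0 < v 0) /\ (exists y v, connection y v /\ v 0 < 0).
Proof.
  (* The bound of [crossing_of_steep_descent] serves both as clip level and as slope range: 3 a^2 <=
     3 r^2 < r^3 when |a| <= r. *)
  set (r := 100000). assert (Hr : 0 < r) by (unfold r; lra).
  assert (Har : forall a, - r <= a <= r -> 3 * a ^ 2 < r ^ 3).
  { intros a Ha. assert (a ^ 2 <= r ^ 2) by nra. unfold r in *. lra. }
  split.
  - destruct (continuous_dichotomy_gap (trapped r) (crosses r) 0 r Hr) as [c [Hc [N1 N2]]].
    + intros x _ Hx. destruct (trapped_open r x ltac:(lra) Hx) as [d [Hd P]].
      exists d. split; [assumption|]. intros t _. apply P.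
    + intros x _ Hx. destruct (crosses_open r x ltac:(lra) Hx) as [d [Hd P]].
      exists d. split; [assumption|]. intros t _. apply P.
    + intros x Hx T C. apply (crosses_trapped_disjoint r x); auto. apply Har; lra.
    + now apply trapped_zero.
    + apply crosses_steep_ascent; unfold r; lra.
    + destruct (neither_connection r c Hr (Har c ltac:(lra)) N2 N1) as [y [v [Hyv V]]].
      exists y, v. rewrite V. split; [assumption|lra].
  - destruct (continuous_dichotomy_gap (crosses r) (trapped r) (- r) 0 ltac:(lra)) as [c [Hc [N1 N2]]].
    + intros x _ Hx. destruct (crosses_open r x ltac:(lra) Hx) as [d [Hd P]].
      exists d. split; [assumption|]. intros t _. apply P.
    + intros x _ Hx. destruct (trapped_open r x ltac:(lra) Hx) as [d [Hd P]].
      exists d. split; [assumption|]. intros t _. apply P.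
    + intros x Hx C T. apply (crosses_trapped_disjoint r x); auto. apply Har; lra.
    + apply crosses_steep_descent; [assumption|apply Har; lra|unfold r; lra].
    + now apply trapped_zero.
    + destruct (neither_connection r c Hr (Har c ltac:(lra)) N1 N2) as [y [v [Hyv V]]].
      exists y, v. rewrite V. split; [assumption|lra].
Qed.

(** * The minimum of the decreasing branch and the conclusion *)

Lemma turning_point_unique_minimum (y v : R -> R) :
  connection y v -> v 0 < 0 -> exists s0, 0 < s0 /\ unique_minimum_at y s0.
Proof.
  intros Hc V0. destruct (connection_turning_point y v Hc V0) as [m [Hm [Vneg [_ [Vpos _]]]]].
  exists m. split; [assumption|]. split; [unfold half_line; lra|].
  intros s Hs ne. destruct (Rtotal_order s m) as [L|[E|G]]; [|contradiction|].
  - apply (derive_neg_lt y v); [assumption| |].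
    + intros t Ht. apply (connection_derive y v Hc). unfold half_line in Hs. lra.
    + intros t Ht. apply Vneg. unfold half_line in Hs. lra.
  - apply (derive_pos_lt y v); [assumption| |].
    + intros t Ht. apply (connection_derive y v Hc). lra.
    + intros t Ht. apply Vpos. lra.
Qed.

Theorem proposition2p1 :
  exists Yp Ym : R -> R,
    bvp_solution Yp /\
    bvp_solution Ym /\
    ~ eq_on_half_line Yp Ym /\
    (forall y : R -> R, bvp_solution y ->
       eq_on_half_line y Yp \/ eq_on_half_line y Ym) /\
    (exists Yp' : R -> R, forall s, half_line s ->
       D_in Yp Yp' half_line s /\ 0 < Yp' s) /\
    (exists Ym' : R -> R, D_in Ym Ym' half_line 0 /\ Ym' 0 < 0) /\
    (exists s0 : R, 0 < s0 /\ unique_minimum_at Ym s0) /\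
    nondegenerate Yp /\
    nondegenerate Ym.
Proof.
  destruct connections_exist as [[Yp [Vp [Hp Pp]]] [Ym [Vm [Hm Nm]]]].
  exists Yp, Ym.
  split; [now apply connection_bvp_solution with Vp|].
  split; [now apply connection_bvp_solution with Vm|].
  split.
  (* At its minimum [Ym] is below [Ym 0] = 0, whereas [Yp] is nonnegative. *)
  { intros E. destruct (turning_point_unique_minimum Ym Vm Hm Nm) as [s0 [Hs0 [_ Min]]].
    specialize (Min 0 (Rle_refl 0) ltac:(lra)).
    pose proof (connection_increasing_nonneg Yp Vp s0 Hp Pp ltac:(lra)).
    rewrite (connection_0 Ym Vm Hm) in Min. rewrite E in H by (unfold half_line; lra). lra. }
  split.
  { intros y Hy. destruct (bvp_solution_connection y Hy) as [Y [V [Hc E]]].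
    destruct (Rtotal_order (V 0) 0) as [N|[Z|P]].
    - right. intros s Hs. rewrite E by assumption.
      now apply decreasing_connection_unique with V Vm.
    - now apply (connection_slope_nonzero Y V Hc) in Z.
    - left. intros s Hs. rewrite E by assumption.
      now apply increasing_connection_unique with V Vp. }
  split.
  { exists Vp. intros s Hs. split.
    - now apply derive_D_in_half_line, (connection_derive Yp Vp Hp).
    - apply (connection_stays_increasing Yp Vp Hp 0); [unfold half_line in Hs; lra|assumption]. }
  split.
  { exists Vm. split; [|assumption].
    apply derive_D_in_half_line, (connection_derive Ym Vm Hm). lra. }
  split; [now apply turning_point_unique_minimum with Vm|].
  split; [now apply increasing_connection_nondegenerate with Vp|].
  now apply decreasing_connection_nondegenerate with Vm.
Qed.
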